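(* Consider the subcritical branching random walk described in the context, with offspring distribution $(p_k)_{k\ge 0}$ of mean $m\in(0,1)$ having a finite third moment, and jump distribution $(a_y)_{y\in\mathbb{Z}}$ with mean zero, finite variance, $a_0<1$, and $K(\theta)<\infty$ for all $\theta\ge 1$. Let $u(n)=P(M\ge n)$ and $\ell(n):=\rho(m^{-1})^{n}\,u(n)$. Then: (a) $0<\liminf_{n\to\infty}\ell(n)\le\limsup_{n\to\infty}\ell(n)\le 1$. (b) Moreover, if $W$ has a finite right range $R$ and is nearly right-continuous, then there exists $\kappa\in(0,1]$ such that $\lim_{n\to\infty}\ell(n)=\kappa$. (c) In either case (that is, whether or not the additional assumption of (b) holds), $$\log\rho(m^{-1})=-\lim_{n\to\infty}\frac{\log E\big(m^{\tau_n}\big)}{n}.$$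
   Context: Branching random walk: $(a_y)_{y\in\mathbb{Z}}$ is the jump distribution and $(p_k)_{k\ge0}$ the offspring distribution. The process starts from a single particle (the root) at position $0$. In each generation particles first jump and then reproduce: each particle $v$ at position $X(v)$, independently of all others, makes a jump $\xi_v$ with $P(\xi_v=y)=a_y$ and then produces $N_v$ children, where $P(N_v=k)=p_k$ and $N_v$ is independent of $\xi_v$; all children of $v$ have position $X(v)+\xi_v$ (if $N_v=0$, the jump leaves no trace). $\mathcal{T}$ is the genealogical Galton–Watson tree, $|v|$ is the generation of $v$ (the root has generation $0$), and $X(v)$ its position. Set $M_n=\max_{v\in\mathcal{T},|v|\le n}X(v)$ and $M=\sup_{n\ge0}M_n$. Random walk: $W=(W_n)_{n\ge0}$ is the random walk on $\mathbb{Z}$ with $W_0=0$ and i.i.d. increments with law $(a_y)$. For $y\ge 0$, $\tau_y=\min\{n\ge0: W_n\ge y\}$. $K(\theta)=E(\theta^{W_1})$ for $\theta\ge1$; under the assumptions $K(1)=1$ and $K$ is strictly increasing to $\infty$ on $[1,\infty)$, and for $\gamma>1$, $\rho(\gamma)$ denotes the unique $s\in(1,\infty)$ with $K(s)=\gamma$. $W$ has a finite right range $R>0$ if $a_R>0$ and $a_k=0$ for all $k>R$; in that case $W$ is nearly right-continuous if $a_i>0$ for all $i=1,\dots,R$. *)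

(* Defs.v *)
From HB Require Import structures.
From mathcomp Require Import all_boot all_order all_algebra.
From mathcomp Require Import finmap.
From mathcomp Require Import all_classical all_reals all_analysis.

Set Implicit Arguments.
Unset Strict Implicit.
Unset Printing Implicit Defensive.

Import Order.TTheory GRing.Theory Num.Theory.
Import numFieldNormedType.Exports.

Local Open Scope classical_set_scope.
Local Open Scope ring_scope.

(* The library equips nat, but not int, with the discrete sigma-algebra. *)
HB.instance Definition _ := isPointed.Build int 0%Z.
HB.instance Definition _ := @isMeasurable.Build default_measure_display
  int discrete_measurable discrete_measurable0
  discrete_measurableC discrete_measurableU.

Section independence.
Context {d} {Omega : measurableType d} {R : realType}.
Variable P : probability Omega R.

Definition independent2 {d1 d2} {T1 : measurableType d1}
    {T2 : measurableType d2} (X : Omega -> T1) (Y : Omega -> T2) : Prop :=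
  forall (A : set T1) (B : set T2), measurable A -> measurable B ->
    P (X @^-1` A `&` Y @^-1` B) = (P (X @^-1` A) * P (Y @^-1` B))%E.

Definition independent_family {I : choiceType} {d'} {T : measurableType d'}
    (X : I -> Omega -> T) : Prop :=
  forall (J : {fset I}) (A : I -> set T), (forall i, measurable (A i)) ->
    P (\bigcap_(i in [set` J]) (X i @^-1` A i)) =
    (\prod_(i <- J) P (X i @^-1` A i))%E.

End independence.

Section random_walk.
Context {d} {Omega : measurableType d} {R : realType}.
Variable P : probability Omega R.

Record is_iid_steps (a : probability int R) (step : nat -> {RV P >-> int})
    : Prop := IsIidSteps {
  step_law : forall i A, measurable A -> distribution P (step i) A = a A ;
  step_indep : independent_family P (fun i w => step i w) }.

Variable step : nat -> {RV P >-> int}.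

Definition walk (n : nat) (w : Omega) : int := \sum_(i < n) step i w.

(* None stands for an infinite hitting time. *)
Definition tau (y : nat) (w : Omega) : option nat :=
  if pselect (exists n, y%:Z <= walk n w) is left h
  then Some (ex_minn h) else None.

(* m ^ tau_y, with m ^ oo = 0 since m is used in ]0, 1[ *)
Definition pow_tau (m : R) (y : nat) (w : Omega) : R :=
  if tau y w is Some n then m ^+ n else 0.

Definition K (theta : R) : \bar R :=
  ('E_P[(fun w => theta ^ walk 1 w)%R])%E.

(* The unique s > 1 with K s = gamma; the default value 1 is returned when
   there is no such s. *)
Definition rho (gamma : R) : R :=
  xget 1 [set s : R | 1 < s /\ K s = gamma%:E].

End random_walk.

Definition right_range {R : realType} (a : probability int R) (r : nat)
    : Prop :=
  [/\ (0 < r)%N, (0 < a [set r%:Z])%E &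
      forall k : int, r%:Z < k -> a [set k] = 0%E].

Definition nearly_right_continuous {R : realType} (a : probability int R)
    (r : nat) : Prop :=
  forall i : nat, (1 <= i <= r)%N -> (0 < a [set i%:Z])%E.

(* Individuals carry Ulam-Harris labels: the root is [::] and the children of
   v are rcons v i for i < N v.  The variables xi v and N v are given for every
   label v, whether or not v is actually born. *)
Section branching_random_walk.
Context {d} {Omega : measurableType d} {R : realType}.
Variable P : probability Omega R.

Record is_brw (a : probability int R) (p : probability nat R)
    (xi : seq nat -> {RV P >-> int}) (N : seq nat -> {RV P >-> nat})
    : Prop := IsBrw {
  brw_jump_law : forall v A, measurable A -> distribution P (xi v) A = a A ;
  brw_offspring_law :
    forall v B, measurable B -> distribution P (N v) B = p B ;
  brw_jump_offspring_indep : forall v, independent2 P (xi v) (N v) ;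
  brw_indep : independent_family P (fun v w => (xi v w, N v w)) }.

Variables (xi : seq nat -> {RV P >-> int}) (N : seq nat -> {RV P >-> nat}).

Definition in_tree (w : Omega) (v : seq nat) : Prop :=
  forall k, (k < size v)%N -> (nth 0 v k < N (take k v) w)%N.

Definition position (v : seq nat) (w : Omega) : int :=
  \sum_(k < size v) xi (take k v) w.

Definition Mn (n : nat) (w : Omega) : \bar R :=
  ereal_sup [set ((position v w)%:~R)%:E |
    v in [set v | in_tree w v /\ (size v <= n)%N]].

Definition M (w : Omega) : \bar R := ereal_sup (range (fun n => Mn n w)).

Definition u (n : nat) : R := fine (P [set w | (n%:R%:E <= M w)%E]).

End branching_random_walk.

(* Main.v *)
Require Import Defs.
From HB Require Import structures.
From mathcomp Require Import all_boot all_order all_algebra.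
From mathcomp Require Import finmap.
From mathcomp Require Import all_classical all_reals all_analysis.
From mathcomp Require Import measurable_realfun.
From mathcomp Require Import ring lra zify.

Set Implicit Arguments.
Unset Strict Implicit.
Unset Printing Implicit Defensive.

Import Order.TTheory GRing.Theory Num.Theory.
Import numFieldNormedType.Exports.

Local Open Scope classical_set_scope.
Local Open Scope ring_scope.

(** Let [u j] be the probability that the branching random walk reaches [j] and
    [v j = E (m ^ tau_j)]; both equal [1] for [j <= 0].  Splitting at the first
    generation (resp. the first step) gives, for [j > 0],
      [u j = E (G (u (j - y)))]   and   [v j = m * E (v (j - y))],
    where [y] has the jump law and [G s = E (1 - (1 - s) ^ N)].  Since [G] is
    [m]-Lipschitz and [m < 1], both equations satisfy a comparison principle in
    the sup norm.

    The function [rho ^ - j] solves the linear equation, so [u <= v] and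
    [u, v <= rho ^ - j].  As [G s >= m s - b s ^ 2] and [m K(rho ^ 2) > 1]
    (Jensen), the minimum of [1] and [c (rho ^ - j + rho ^ (- 2 j))] is a
    subsolution for small [c], whence [u >= c rho ^ - j].  This gives (a) and (c).

    For (b), put [h n = rho ^ n * u n] and let [H] be its limsup.  If [h n] is
    close to [H], then so is [h (n - i)] for [1 <= i <= r], because each such [i]
    has positive mass.  The walk cannot jump over a window of length [r], so the
    comparison principle, applied beyond the window to
    [s rho ^ - n + A rho ^ (- 2 n)], keeps [h] close to [H] forever after. *)

(** * Product laws on configuration spaces *)

Section dynkin_uniqueness.
Local Open Scope ereal_scope.
Context {d} {T : measurableType d} {R : realType}.
Variable P : probability T R.

(** Dynkin's argument: the sets on which the law of [f] and [Q] agree are closed under complement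
    and disjoint countable union, so agreement on a generating class stable under intersection
    extends to the whole sigma-algebra. *)
Lemma law_unique d' (T' : measurableType d') (Q : probability T' R)
    (f : T -> T') (G : set (set T')) :
  measurable_fun setT f -> @measurable _ T' = <<s G >> -> setI_closed G ->
  (forall S, G S -> P (f @^-1` S) = Q S) ->
  forall S, measurable S -> P (f @^-1` S) = Q S.
Proof.
move=> mf GE GI PQ S mS.
have mpre A : measurable A -> measurable (f @^-1` A).
  by move=> mA; rewrite -[X in measurable X]setTI; exact: mf.
have {mS} : <<s G >> S by rewrite -GE.
move: S; apply: (dynkin_induction GE GI).
- by rewrite preimage_setT !probability_setT.
- by move=> S GS; exact: PQ.
- move=> S mS PS; rewrite preimage_setC !probability_setC ?PS//.
  exact: mpre.
- move=> F mF tF PF; rewrite preimage_bigcup !measure_semi_bigcup//.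
  + by apply: eq_eseriesr => n _; exact: PF.
  + exact: bigcup_measurable.
  + by move=> i; exact: mpre.
  + by move=> i j _ _ [x [Fi Fj]]; apply: tF => //; exists (f x).
  + by apply: bigcup_measurable => i _; exact: mpre.
Qed.

(** For a fixed [A], the events independent of [A] form a Dynkin system. *)
Lemma indep_half (A : set T) (G : set (set T)) :
  measurable A -> G `<=` measurable -> setI_closed G ->
  (forall B, G B -> P (A `&` B) = P A * P B) ->
  forall B, <<s G >> B -> P (A `&` B) = P A * P B.
Proof.
move=> mA mG GI PG B sGB.
have sGm : <<s G >> `<=` measurable.
  by apply: smallest_sub => //; exact: sigma_algebra_measurable.
have PAf : P A \is a fin_num by exact: fin_num_measure.
move: B sGB; apply: (@dynkin_induction _ (g_sigma_algebraType G) G) => //.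
- by rewrite setIT probability_setT mule1.
- move=> S /sGm mS PS; rewrite -setDE.
  rewrite measureD//; last first.
    by rewrite (le_lt_trans (probability_le1 P mA))// ltry.
  transitivity (P A - P A * P S); first by congr (_ - _); exact: PS.
  rewrite (_ : P (~` S) = 1 - P S); last exact: probability_setC.
  by rewrite muleBr ?mule1//.
- move=> F /(_ _)/sGm mF tF PF; rewrite setI_bigcupr !measure_semi_bigcup//.
  + rewrite -[X in _ = X * _](fineK PAf) -nneseriesZl//.
    apply: eq_eseriesr => n _; rewrite fineK//.
    exact: PF.
  + exact: bigcup_measurable.
  + by move=> i; apply: measurableI => //; exact: mF.
  + exact: trivIset_setIl.
  + by apply: bigcup_measurable => i _; apply: measurableI => //; exact: mF.
Qed.

(** The one-sided extension [indep_half] is used twice, once for each factor. *)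
Lemma indep_gen (G1 G2 : set (set T)) :
  G1 `<=` measurable -> G2 `<=` measurable ->
  setI_closed G1 -> setI_closed G2 ->
  (forall A B, G1 A -> G2 B -> P (A `&` B) = P A * P B) ->
  forall A B, <<s G1 >> A -> <<s G2 >> B -> P (A `&` B) = P A * P B.
Proof.
move=> mG1 mG2 GI1 GI2 PG A B sA sB.
have mB : measurable B.
  by apply: (@smallest_sub _ _ _ _ _ mG2 _ sB); exact: sigma_algebra_measurable.
rewrite setIC muleC; apply: (@indep_half B G1) => // {sA}A GA.
rewrite setIC muleC.
by apply: (@indep_half A G2) => //; [exact: mG1|move=> C GC; exact: PG].
Qed.

End dynkin_uniqueness.

(** * Cylinders, relabelling and independence under a product law *)

Section product_law.
Context {I : choiceType} {dT} {T : measurableType dT} {R : realType}.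

Definition cylinder (J : {fset I}) (A : I -> set T) : set (I -> T) :=
  [set z | forall i, i \in J -> A i (z i)].

(** The parameter [D] records which coordinates may be inspected: [<<s cylinders D >>] is the
    sigma-algebra generated by the coordinates in [D]. *)
Definition cylinders (D : set I) : set (set (I -> T)) :=
  [set C | exists J A, [/\ [set` J] `<=` D, forall i, measurable (A i) &
                           C = cylinder J A]].

Definition config := g_sigma_algebraType (cylinders setT).

(** Padding by [setT] brings two cylinders to a common finite base. *)
Definition extend (J : {fset I}) (A : I -> set T) (i : I) : set T :=
  if i \in J then A i else setT.

Lemma measurable_extend (J : {fset I}) (A : I -> set T) :
  (forall i, measurable (A i)) -> forall i, measurable (extend J A i).
Proof. by move=> mA i; rewrite /extend; case: ifP. Qed.

Lemma cylinder_extend (J K : {fset I}) (A : I -> set T) :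
  {subset J <= K} -> cylinder J A = cylinder K (extend J A).
Proof.
move=> JK; apply/seteqP; split => [z zA i _|z zA i iJ].
  by rewrite /extend; case: ifPn => // iJ; exact: zA.
by have := zA i (JK _ iJ); rewrite /extend iJ.
Qed.

Lemma cylinderI (K : {fset I}) (A B : I -> set T) :
  cylinder K A `&` cylinder K B = cylinder K (fun i => A i `&` B i).
Proof.
apply/seteqP; split => [z [zA zB] i iK|z zAB]; first by split; [exact: zA|exact: zB].
by split=> i /zAB[].
Qed.

Lemma cylinders_setI D : setI_closed (cylinders D).
Proof.
move=> _ _ [J [A [JD mA ->]]] [J' [A' [JD' mA' ->]]].
exists (J `|` J')%fset, (fun i => extend J A i `&` extend J' A' i); split.
- by move=> i /=; rewrite in_fsetU => /orP[/JD|/JD'].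
- by move=> i; apply: measurableI; exact: measurable_extend.
- rewrite (@cylinder_extend J (J `|` J')%fset)//; last exact/fsubsetP/fsubsetUl.
  rewrite (@cylinder_extend J' (J `|` J')%fset)//; last exact/fsubsetP/fsubsetUr.
  exact: cylinderI.
Qed.

Lemma sub_cylinders D D' : D `<=` D' -> <<s cylinders D >> `<=` <<s cylinders D' >>.
Proof.
move=> DD'; apply: sub_sigma_algebra2 => C [J [A [JD mA ->]]].
by exists J, A; split=> //; exact: subset_trans DD'.
Qed.

Lemma cylinders_coord (D : set I) i (A : set T) : D i -> measurable A ->
  <<s cylinders D >> [set z | A (z i)].
Proof.
move=> Di mA; apply: sub_sigma_algebra; exists [fset i]%fset, (fun=> A); split=> //.
- by move=> j /=; rewrite inE => /eqP ->.
- apply/seteqP; split => [z zA j|z zA]; first by rewrite inE => /eqP ->.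
  by apply: zA; rewrite inE.
Qed.

(** With [e = cons i] this is the configuration seen from child [i] of the root; with [e = succn] it
    is the walk after its first step. *)
Definition reindex (e : I -> I) (z : I -> T) : I -> T := z \o e.

Lemma cylinder_reindex (e : I -> I) (J : {fset I}) (A : I -> set T) :
  injective e -> (forall i, measurable (A i)) ->
  exists2 A' : I -> set T, (forall i, measurable (A' i)) &
    (forall i, i \in J -> A' (e i) = A i) /\
    reindex e @^-1` cylinder J A = cylinder (e @` J)%fset A'.
Proof.
move=> inje mA.
(* By injectivity at most one [i] constrains [k]; off the image of [J] the condition is void and
   [A' k] is the full space. *)
pose A' k := [set t | forall i, i \in J -> e i = k -> A i t].
have A'e i : i \in J -> A' (e i) = A i.
  move=> iJ; apply/seteqP; split => [t|t Ait j jJ /inje ->//].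
  exact.
exists A' => [k|].
  have [[i [iJ <-]]|nk] := pselect (exists i, i \in J /\ e i = k).
    by rewrite A'e.
  rewrite (_ : A' k = setT)//; apply/seteqP; split => // t _ i iJ eik.
  by case: nk; exists i.
split=> //; apply/seteqP; split => [z zA k /imfsetP[i /= iJ ->]|z zA i iJ].
  by rewrite A'e//; exact: zA.
by have := zA (e i) (in_imfset _ _ iJ); rewrite A'e.
Qed.

Lemma reindex_cylinders (D : set I) (e : I -> I) E :
  injective e -> range e `<=` D -> <<s cylinders setT >> E ->
  <<s cylinders D >> (reindex e @^-1` E).
Proof.
move=> inje eD sE.
pose T1 := g_sigma_algebraType (cylinders D).
have : measurable_fun setT (reindex e : T1 -> config).
  apply: (@measurability _ _ T1 config setT (reindex e) (cylinders setT) erefl).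
  move=> _ [_ [J [A [_ mA ->]]] <-]; rewrite setTI.
  have [A' mA' [_ ->]] := cylinder_reindex J inje mA.
  apply: sub_sigma_algebra; exists (e @` J)%fset, A'; split=> //.
  by move=> k /= /imfsetP[i _ ->]; apply: eD; exists i.
by move=> /(_ measurableT E sE); rewrite setTI.
Qed.

Variables (mu : probability T R) (nu : probability config R).

Definition is_product_law := forall J A, (forall i, measurable (A i)) ->
  nu (cylinder J A) = (\prod_(i <- J) mu (A i))%E.

Hypothesis nuE : is_product_law.

(** Coordinates are identically distributed, so an injective relabelling preserves the measure of
    cylinders. This is why a subtree has the law of the whole tree. *)
Lemma product_law_reindex (e : I -> I) E : injective e -> <<s cylinders setT >> E ->
  nu (reindex e @^-1` E) = nu E.
Proof.
move=> inje; move: E.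
apply: (@law_unique _ _ _ nu _ config nu (reindex e) (cylinders setT)) => //.
- move=> _ E sE; rewrite setTI; exact: reindex_cylinders.
- exact: cylinders_setI.
- move=> _ [J [A [_ mA ->]]].
  have [A' mA' [A'e ->]] := cylinder_reindex J inje mA.
  rewrite !nuE// big_imfset/=; last by move=> i j _ _; exact: inje.
  by rewrite big_seq [RHS]big_seq; apply: eq_bigr => i iJ; rewrite A'e.
Qed.

Lemma cylinders_measurable (D : set I) :
  cylinders D `<=` (@measurable _ config : set (set config)).
Proof.
move=> C CD; apply: (@sub_cylinders D setT) => //.
exact: sub_sigma_algebra.
Qed.

Lemma product_law_indep (D1 D2 : set I) E1 E2 : D1 `&` D2 = set0 ->
  <<s cylinders D1 >> E1 -> <<s cylinders D2 >> E2 ->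
  nu (E1 `&` E2) = (nu E1 * nu E2)%E.
Proof.
move=> D12; apply: (@indep_gen _ config _ nu) E1 E2.
- exact: cylinders_measurable.
- exact: cylinders_measurable.
- exact: cylinders_setI.
- exact: cylinders_setI.
move=> _ _ [J [A [JD mA ->]]] [J' [A' [JD' mA' ->]]].
rewrite (@cylinder_extend J (J `|` J')%fset)//; last exact/fsubsetP/fsubsetUl.
rewrite (@cylinder_extend J' (J `|` J')%fset)//; last exact/fsubsetP/fsubsetUr.
rewrite cylinderI !nuE; try exact: measurable_extend; last first.
  by move=> i; apply: measurableI; exact: measurable_extend.
(* As [D1] and [D2] are disjoint, at each index at least one of the two padded factors is [setT], of
   mass 1. *)
rewrite -big_split/=; apply: eq_bigr => i _.
rewrite /extend; have [iJ|iJ] := boolP (i \in J); last first.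
  by rewrite setTI probability_setT mul1e.
have [iJ'|_] := boolP (i \in J'); last by rewrite setIT probability_setT mule1.
by have : (D1 `&` D2) i by [split; [exact: JD|exact: JD']]; rewrite D12.
Qed.

End product_law.

(** * Means of functions on discrete spaces *)

Section discrete_mean.
Context {d} {T : measurableType d} {R : realType}.
Variable P : probability T R.
Definition mean (f : T -> R) : R := \int[P]_x f x.
Definition summable_fun (f : T -> R) : Prop := P.-integrable setT (EFin \o f).

Lemma EFin_mean f : summable_fun f -> (\int[P]_x (f x)%:E = (mean f)%:E)%E.
Proof.
by move=> sf; rewrite /mean /Rintegral fineK//; exact: integrable_fin_num sf.
Qed.

Lemma summable_cst c : summable_fun (fun=> c).
Proof. exact: finite_measure_integrable_cst. Qed.

Lemma summableD f g : summable_fun f -> summable_fun g ->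
  summable_fun (fun x => f x + g x).
Proof. by move=> sf sg; exact: (integrableD _ sf sg). Qed.

Lemma summableZ c f : summable_fun f -> summable_fun (fun x => c * f x).
Proof. by move=> sf; apply: (integrableZl _ c sf). Qed.

Lemma summableB f g : summable_fun f -> summable_fun g ->
  summable_fun (fun x => f x - g x).
Proof. by move=> sf sg; exact: (integrableB _ sf sg). Qed.

Lemma mean_cst c : mean (fun=> c) = c.
Proof.
transitivity (c * fine (P setT)); first exact: Rintegral_cst.
by rewrite probability_setT mulr1.
Qed.

Lemma meanD f g : summable_fun f -> summable_fun g ->
  mean (fun x => f x + g x) = mean f + mean g.
Proof. by move=> sf sg; rewrite /mean RintegralD. Qed.

Lemma meanB f g : summable_fun f -> summable_fun g ->
  mean (fun x => f x - g x) = mean f - mean g.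
Proof. by move=> sf sg; rewrite /mean RintegralB. Qed.

Lemma meanZ c f : summable_fun f -> mean (fun x => c * f x) = c * mean f.
Proof. by move=> sf; rewrite /mean RintegralZl. Qed.

Lemma le_mean f g : summable_fun f -> summable_fun g ->
  (forall x, f x <= g x) -> mean f <= mean g.
Proof. by move=> sf sg fg; apply: le_Rintegral. Qed.

Lemma mean_ge0 f : (forall x, 0 <= f x) -> 0 <= mean f.
Proof. by move=> f0; apply: Rintegral_ge0. Qed.

Lemma eq_mean f g : f =1 g -> mean f = mean g.
Proof. by move=> fg; congr mean; apply/funext. Qed.

(** Jensen's inequality for the square, obtained by expanding the nonnegative mean of [(f - c) ^+ 2]
    with [c = mean f]. *)
Lemma mean_sqr_ge f : summable_fun f -> summable_fun (fun x => f x ^+ 2) ->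
  mean f ^+ 2 <= mean (fun x => f x ^+ 2).
Proof.
move=> sf sf2; set c := mean f.
have : 0 <= mean (fun x => f x ^+ 2 - 2 * c * f x + c ^+ 2).
  apply: mean_ge0 => x; rewrite (_ : _ + _ = (f x - c) ^+ 2) ?sqr_ge0//.
  by ring.
rewrite meanD; [|by apply: summableB => //; exact: summableZ|exact: summable_cst].
rewrite meanB//; last exact: summableZ.
rewrite meanZ// mean_cst -/c; nra.
Qed.

Hypothesis discrete : forall A : set T, measurable A.

Lemma discrete_measurable_fun d' (T' : sigmaRingType d') (f : T -> T') :
  measurable_fun setT f.
Proof. by move=> _ A _; exact: discrete. Qed.

Lemma summable_dom f g : summable_fun g -> (forall x, `|f x| <= g x) ->
  summable_fun f.
Proof.
move=> sg fg; apply: (le_integrable measurableT _ _ sg); first exact: discrete_measurable_fun.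
move=> x _ /=; rewrite lee_fin; apply: (le_trans (fg x)); exact: ler_norm.
Qed.

Lemma summable_bounded f c : (forall x, `|f x| <= c) -> summable_fun f.
Proof. by apply: summable_dom; exact: summable_cst. Qed.

Lemma eq_mean_ae f g (A : set T) : P (~` A) = 0%E -> (forall x, A x -> f x = g x) ->
  mean f = mean g.
Proof.
move=> PA fg; rewrite /mean /Rintegral; congr fine.
apply: ae_eq_integral => //; try exact: discrete_measurable_fun.
exists (~` A); split=> // x /= nfg Ax; apply: nfg => _; by rewrite fg.
Qed.

Lemma mean_indic (x : T) : mean (fun y => (y \in [set x])%:R) = fine (P [set x]).
Proof.
rewrite /mean /Rintegral; congr fine.
by rewrite -[in RHS](setIT [set x]) -(integral_indic P measurableT).
Qed.

End discrete_mean.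

(** * Comparison principle *)

Lemma int_discrete (A : set int) : measurable A. Proof. by []. Qed.

Lemma null_above {R : realType} (a : probability int R) (r : nat) :
  (forall k : int, r%:Z < k -> a [set k] = 0%E) ->
  a (~` [set y | y <= r%:Z]) = 0%E.
Proof.
move=> ar.
have -> : ~` [set y : int | y <= r%:Z] = \bigcup_k [set r%:Z + k.+1%:Z].
  apply/seteqP; split => [y /= yr|y [k _ ->]] /=.
    by exists `|y - r%:Z|.-1%N => //=; lia.
  lia.
rewrite measure_semi_bigcup//.
- by apply: eseries0 => k _ _; apply: ar; lia.
- by move=> i j _ _ [y [/= -> e]]; lia.
Qed.


Section comparison.
Context {R : realType}.
Variables (a : probability int R) (m : R).
Hypothesis m_bounds : 0 < m < 1.

Local Notation E := (mean a).

(* The supremum of the positive part of [V] is at most [m] times itself. *)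
Lemma comparison (V : int -> R) (N : int) C :
  (forall n, V n <= C) -> (forall n, n <= N -> V n <= 0) ->
  (forall n, N < n -> V n <= m * E (fun y => Num.max 0 (V (n - y)))) ->
  forall n, V n <= 0.
Proof.
move=> VC VN VE.
have [m0 m1] := andP m_bounds.
pose D := Num.max 0 C.
have D0 : 0 <= D by rewrite le_max lexx.
have VD k n : V n <= m ^+ k * D.
  elim: k n => [|k IH] n; first by rewrite mul1r le_max VC orbT.
  have [nN|Nn] := leP n N.
    by apply: (le_trans (VN n nN)); rewrite mulr_ge0// exprn_ge0// ltW.
  apply: (le_trans (VE n Nn)); rewrite exprS -mulrA ler_pM2l//.
  rewrite -[leRHS](mean_cst a). apply: le_mean.
  - apply: (@summable_bounded _ _ _ a int_discrete _ (m ^+ k * D)) => y.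
    rewrite ger0_norm ?le_max ?lexx// ge_max IH andbT.
    by rewrite mulr_ge0// exprn_ge0// ltW.
  - exact: summable_cst.
  - by move=> y; rewrite ge_max IH andbT mulr_ge0// exprn_ge0// ltW.
move=> n; have cv : (fun k => m ^+ k * D) @ \oo --> (0 : R).
  rewrite -[X in _ --> X](mul0r D); apply: cvgMl.
  by apply: cvg_expr; rewrite ger0_norm// ltW.
rewrite -(cvg_lim _ cv)//; apply: limr_ge; first by apply/cvg_ex; exists 0.
by apply: nearW => k; exact: VD.
Qed.

(* No jump exceeds [r], so values at or below [N - r] are never used. *)
Lemma comparison_window (r : nat) (V : int -> R) (N : int) C :
  (forall k : int, r%:Z < k -> a [set k] = 0%E) ->
  (forall n, N - r%:Z < n -> V n <= C) ->
  (forall n, N - r%:Z < n <= N -> V n <= 0) ->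
  (forall n, N < n -> V n <= m * E (fun y => Num.max 0 (V (n - y)))) ->
  forall n, N - r%:Z < n -> V n <= 0.
Proof.
move=> ar VC VN VE.
pose W (n : int) := if N - r%:Z < n then V n else 0.
suff W0 n : W n <= 0 by move=> n Nn; have := W0 n; rewrite /W Nn.
apply: (@comparison W N (Num.max 0 C)) => {}n.
- by rewrite /W; case: ifPn => Nn; rewrite le_max ?lexx// VC// orbT.
- by move=> nN; rewrite /W; case: ifPn => // Nn; apply: VN; rewrite Nn.
move=> Nn; rewrite /W ifT; last first.
  by apply: le_lt_trans Nn; rewrite gerBl.
apply: (le_trans (VE n Nn)); rewrite le_eqVlt; apply/orP; left; apply/eqP.
congr (_ * _); apply: (@eq_mean_ae _ _ _ _ int_discrete _ _ [set y | y <= r%:Z]).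
  exact: null_above ar.
by move=> y /= yr; rewrite /W ifT//; lia.
Qed.

End comparison.

(** * The renewal equation *)

Lemma positive_lower_bound {R : realType} (f : nat -> R) (r : nat) :
  (forall i : nat, (1 <= i <= r)%N -> 0 < f i) ->
  exists2 alpha : R, 0 < alpha & forall i : nat, (1 <= i <= r)%N -> alpha <= f i.
Proof.
elim: r => [|r IH] f0; first by exists 1 => // i; case: i.
have [i /andP[i1 ir]|alpha alpha0 fi] := IH.
  by apply: f0; rewrite i1 (leq_trans ir).
exists (Num.min alpha (f r.+1)); first by rewrite lt_min alpha0 f0//=.
move=> i /andP[i1]; rewrite leq_eqVlt ltnS => /orP[/eqP ->|ir].
  by rewrite ge_min lexx orbT.
by rewrite ge_min fi// i1.
Qed.

Lemma cvg_from_below {R : realType} (h : nat -> R) (H : R) :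
  (forall e, 0 < e -> exists N, forall n, (N <= n)%N -> h n <= H + e) ->
  (forall e, 0 < e -> exists N, forall n, (N <= n)%N -> H - e <= h n) ->
  h @ \oo --> H.
Proof.
move=> hu hl; apply/cvgrPdist_le => e e0.
have [N1 h1] := hu e e0; have [N2 h2] := hl e e0.
near=> n.
have n1 : (N1 <= n)%N by near: n; exact: nbhs_infty_ge.
have n2 : (N2 <= n)%N by near: n; exact: nbhs_infty_ge.
by rewrite ler_distl; have := h1 n n1; have := h2 n n2; lra.
Unshelve. all: by end_near.
Qed.

Section renewal_equation.
Context {R : realType}.
Variables (a : probability int R) (m rho : R).
Hypothesis m_bounds : 0 < m < 1.
Hypothesis rho_gt1 : 1 < rho.
Hypothesis summable_rho : forall i : nat, summable_fun a (fun y : int => (rho ^ y) ^+ i).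

Local Notation E := (mean a).
Local Notation "'kappa' i" := (E (fun y : int => (rho ^ y) ^+ i)) (at level 10).
Hypothesis kappa1 : m * kappa 1 = 1.

Let m_gt0 : 0 < m. Proof. by case/andP: m_bounds. Qed.
Let m_lt1 : m < 1. Proof. by case/andP: m_bounds. Qed.
Let rho_gt0 : 0 < rho. Proof. exact: lt_trans rho_gt1. Qed.
Let rho_neq0 : rho != 0. Proof. by rewrite gt_eqF. Qed.

Definition decay (n : int) : R := rho ^ (- n).

Lemma decay_gt0 n : 0 < decay n.
Proof. exact: exprz_gt0. Qed.

Lemma decayB n y : decay (n - y) = decay n * rho ^ y.
Proof. by rewrite /decay opprB addrC expfzDr. Qed.

Lemma decay_ge1 n : n <= 0 -> 1 <= decay n.
Proof.
by move=> n0; rewrite /decay -[X in X <= _](expr0z rho) ler_eXz2l// oppr_ge0.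
Qed.

Lemma decay_le1 n : 0 <= n -> decay n <= 1.
Proof.
by move=> n0; rewrite /decay -[X in _ <= X](expr0z rho) ler_eXz2l// oppr_le0.
Qed.

Lemma decay_le n k : n <= k -> decay k <= decay n.
Proof. by move=> nk; rewrite /decay ler_eXz2l// lerN2. Qed.

Lemma summable_decay n i : summable_fun a (fun y => decay (n - y) ^+ i).
Proof.
rewrite (_ : (fun y => _) = fun y => decay n ^+ i * (rho ^ y) ^+ i).
  exact: summableZ.
by apply/funext => y; rewrite decayB exprMn.
Qed.

Lemma mean_decay n i : E (fun y => decay (n - y) ^+ i) = decay n ^+ i * kappa i.
Proof. by rewrite -meanZ//; apply: eq_mean => y; rewrite decayB exprMn. Qed.

Lemma summable_decay1 n : summable_fun a (fun y => decay (n - y)).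
Proof. exact: (summable_decay n 1). Qed.

(** The choice of [rho], in the form [kappa1], makes [decay] an exact solution of the linear
    equation. *)
Lemma mean_decay1 n : m * E (fun y => decay (n - y)) = decay n.
Proof. by rewrite (mean_decay n 1) mulrCA kappa1 mulr1. Qed.

(** Jensen gives [kappa 2 >= kappa 1 ^+ 2 = m^-1 ^+ 2]. The strict gap lets a term in [decay ^+ 2]
    absorb second-order errors. *)
Lemma mkappa2_gt1 : 1 < m * kappa 2.
Proof.
have k1 : kappa 1 = m^-1.
  by apply: (mulfI (lt0r_neq0 m_gt0)); rewrite kappa1 divff// gt_eqF.
have := mean_sqr_ge (summable_rho 1) (summable_rho 2).
rewrite k1 => h.
apply: (@lt_le_trans _ _ (m * m^-1 ^+ 2)); last by rewrite ler_pM2l.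
by rewrite expr2 mulrA divff ?gt_eqF// mul1r invf_gt1.
Qed.

(** * Subsolutions of the linear equation *)

Section unit_valued.
Variable w : int -> R.
Hypothesis w01 : forall n, 0 <= w n <= 1.

Lemma summable_unit n : summable_fun a (fun y => w (n - y)).
Proof.
apply: (@summable_bounded _ _ _ a int_discrete _ 1) => y.
by have /andP[w0 w1] := w01 (n - y); rewrite ger0_norm.
Qed.

Lemma summable_pos_part (V : int -> R) n : (forall k, 0 <= V k) ->
  summable_fun a (fun y => Num.max 0 (w (n - y) - V (n - y))).
Proof.
move=> V0.
apply: (@summable_bounded _ _ _ a int_discrete _ 1) => y.
have /andP[w0 w1] := w01 (n - y); rewrite ger0_norm ?le_max ?lexx//.
by rewrite ge_max ler01/= lerBlDr (le_trans w1)// lerDl.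
Qed.

(** Comparison applied to [w - decay]: although [decay] is unbounded on the left, the difference is
    bounded above by 1, and it is nonpositive on [n <= 0], where [decay] is at least 1. *)
Lemma subsolution_le_decay :
  (forall n, 0 < n -> w n <= m * E (fun y => w (n - y))) ->
  forall n, w n <= decay n.
Proof.
move=> wE n; rewrite -subr_le0; move: n.
apply: (@comparison _ a m m_bounds _ 0 1) => n.
- have /andP[_ w1] := w01 n; have := decay_gt0 n; lra.
- by move=> n0; have /andP[_ w1] := w01 n; have := decay_ge1 n0; lra.
move=> n0; rewrite lerBlDr -[X in _ + X]mean_decay1 -mulrDr -meanD.
- apply: (le_trans (wE n n0)); rewrite ler_pM2l//; apply: le_mean.
  + exact: summable_unit.
  + apply: summableD; last exact: summable_decay1.
    by apply: summable_pos_part => k; exact/ltW/decay_gt0.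
  + by move=> y; rewrite -lerBlDr le_max lexx orbT.
- by apply: summable_pos_part => k; exact/ltW/decay_gt0.
- exact: summable_decay1.
Qed.

End unit_valued.

Lemma subsolution_le_solution (w v : int -> R) :
  (forall n, 0 <= w n <= 1) -> (forall n, 0 <= v n <= 1) ->
  (forall n, n <= 0 -> v n = 1) ->
  (forall n, 0 < n -> w n <= m * E (fun y => w (n - y))) ->
  (forall n, 0 < n -> v n = m * E (fun y => v (n - y))) ->
  forall n, w n <= v n.
Proof.
move=> w01 v01 v1 wE vE n; rewrite -subr_le0; move: n.
have v_ge0 k : 0 <= v k by case/andP: (v01 k).
apply: (@comparison _ a m m_bounds _ 0 1) => n.
- have /andP[_ wn] := w01 n; have /andP[vn _] := v01 n; lra.
- by move=> n0; have /andP[_ wn] := w01 n; rewrite v1// subr_le0.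
move=> n0; rewrite lerBlDr (vE n n0) -mulrDr -meanD.
- apply: (le_trans (wE n n0)); rewrite ler_pM2l//; apply: le_mean.
  + exact: summable_unit.
  + by apply: summableD; [exact: summable_pos_part|exact: summable_unit].
  + by move=> y; rewrite -lerBlDr le_max lexx orbT.
- exact: summable_pos_part.
- exact: summable_unit.
Qed.

(** * The nonlinear equation and two-sided bounds for its solution *)

Section nonlinear.
Variables (G : R -> R) (b : R) (u : int -> R).
Hypothesis b_ge0 : 0 <= b.
Hypothesis G_bounds : forall s, 0 <= s <= 1 -> 0 <= G s <= 1.
Hypothesis G_lip : forall s t, 0 <= s <= 1 -> 0 <= t <= 1 ->
  G s <= G t + m * Num.max 0 (s - t).
Hypothesis G0 : G 0 = 0.
Hypothesis G_ge : forall t, 0 <= t -> m * t - b * t ^+ 2 <= G (Num.min 1 t).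
Hypothesis u01 : forall n, 0 <= u n <= 1.
Hypothesis u1 : forall n, n <= 0 -> u n = 1.
Hypothesis uE : forall n, 0 < n -> u n = E (fun y => G (u (n - y))).

Let summable_G (w : int -> R) n : (forall n, 0 <= w n <= 1) ->
  summable_fun a (fun y => G (w (n - y))).
Proof. by move=> w01; apply: (@summable_unit (G \o w)) => k; exact: G_bounds. Qed.

Lemma G_le s : 0 <= s <= 1 -> G s <= m * s.
Proof.
move=> s01; have := @G_lip s 0 s01; rewrite lexx ler01 => /(_ isT).
rewrite G0 add0r subr0; move/le_trans; apply; rewrite ler_pM2l//.
by case/andP: s01 => s0 _; rewrite ge_max s0 lexx.
Qed.

Lemma solution_subsolution n : 0 < n -> u n <= m * E (fun y => u (n - y)).
Proof.
move=> n0; rewrite uE// -meanZ; last exact: summable_unit.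
apply: le_mean => [||y]; [exact: summable_G| |exact: G_le].
by apply: summableZ; exact: summable_unit.
Qed.

Lemma solution_le_decay n : u n <= decay n.
Proof. by apply: subsolution_le_decay => // k; exact: solution_subsolution. Qed.

(** The bound [G_lip] turns the nonlinear inequality into a linear one for the positive part of
    [w - u], to which [comparison] applies. *)
Lemma subsolution_le (w : int -> R) : (forall n, 0 <= w n <= 1) ->
  (forall n, 0 < n -> w n <= E (fun y => G (w (n - y)))) ->
  forall n, w n <= u n.
Proof.
move=> w01 wE n; rewrite -subr_le0; move: n.
have u_ge0 k : 0 <= u k by case/andP: (u01 k).
apply: (@comparison _ a m m_bounds _ 0 1) => n.
- have /andP[_ wn] := w01 n; have /andP[un _] := u01 n; lra.
- by move=> n0; have /andP[_ wn] := w01 n; rewrite u1// subr_le0.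
move=> n0; rewrite lerBlDr (uE n0) -meanZ; last exact: summable_pos_part.
rewrite -meanD; [|by apply: summableZ; exact: summable_pos_part|exact: summable_G].
apply: (le_trans (wE n n0)); apply: le_mean => [||y].
- exact: summable_G.
- by apply: summableD; [apply: summableZ; exact: summable_pos_part|exact: summable_G].
- by rewrite [leRHS]addrC; exact: G_lip.
Qed.

(** In the subsolution [Num.min 1 (psi n)] below, the first-order term reproduces itself and the
    second-order term is multiplied by [m * kappa 2 > 1]; for small [c] this gain of order [c] beats
    the quadratic loss of order [c ^+ 2]. *)
Lemma solution_ge_decay : exists2 c : R, 0 < c & forall n, 0 <= n -> c * decay n <= u n.
Proof.
(* These are the coefficients of [(x + x ^+ 2) ^+ 2], each power of [x] weighted by its moment; for
   [0 <= x <= 1] all powers are then bounded by [x ^+ 2]. *)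
pose D := kappa 2 + 2 * kappa 3 + kappa 4.
have kge0 i : 0 <= kappa i by apply: mean_ge0 => y; rewrite exprn_ge0// exprz_ge0// ltW.
have D0 : 0 <= D by rewrite !addr_ge0// mulr_ge0.
have gap : 0 < m * kappa 2 - 1 by rewrite subr_gt0 mkappa2_gt1.
have bD : 0 < b * D + 1 by rewrite ltr_wpDl// mulr_ge0.
(* The first bound keeps [c * decay n] below 1 for [n >= 0]; the second makes the loss [c * (b * D)]
   at most the gap. The added 1 keeps the denominator positive. *)
pose c := Num.min (1 / 2) ((m * kappa 2 - 1) / (b * D + 1)).
have c0 : 0 < c by rewrite lt_min divr_gt0//= divr_gt0.
have c_half : c <= 1 / 2 by rewrite ge_min lexx.
have cgap : c * (b * D) <= m * kappa 2 - 1.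
  have : c * (b * D + 1) <= m * kappa 2 - 1.
    by rewrite -ler_pdivlMr// ge_min lexx orbT.
  by rewrite mulrDr mulr1; lra.
(* The second term of [psi] absorbs the quadratic loss in [G]. *)
pose psi n := c * (decay n + decay n ^+ 2).
have psi_ge0 n : 0 <= psi n.
  by rewrite mulr_ge0// ?ltW// addr_gt0// ?exprn_gt0// decay_gt0.
exists c => // n n0.
apply: (@le_trans _ _ (Num.min 1 (psi n))).
  rewrite le_min; apply/andP; split.
    have := decay_le1 n0; have := decay_gt0 n; nra.
  by rewrite ler_pM2l// lerDl exprn_ge0// ltW// decay_gt0.
apply: (subsolution_le (w := fun n => Num.min 1 (psi n))) => {n n0} n.
  by rewrite le_min ler01 psi_ge0 ge_min lexx.
move=> n0; rewrite ge_min; apply/orP; right.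
have sd i := summable_decay n i.
(* This minorant from [G_ge] is a polynomial in [decay (n - y)], so its mean is explicit in the
   moments [kappa i]. *)
pose lo y := m * psi (n - y) - b * psi (n - y) ^+ 2.
have loE : lo = fun y => m * c * decay (n - y) ^+ 1 + (m * c - b * c ^+ 2) * decay (n - y) ^+ 2
    + (- (2 * b * c ^+ 2)) * decay (n - y) ^+ 3 + (- (b * c ^+ 2)) * decay (n - y) ^+ 4.
  by apply/funext => y; rewrite /lo /psi; ring.
have slo : summable_fun a lo by rewrite loE; do !apply: summableD; apply: summableZ.
apply: (@le_trans _ _ (E lo)); last first.
  apply: le_mean => // [|y]; last exact: G_ge.
  apply: (@summable_G (fun n => Num.min 1 (psi n))) => k.
  by rewrite le_min ler01 psi_ge0 ge_min lexx.
rewrite loE !meanD ?meanZ//; try by do ?apply: summableD; apply: summableZ.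
rewrite !mean_decay /psi.
have x0 := decay_gt0 n; have x1 : decay n <= 1 by apply: decay_le1; rewrite ltW.
set x := decay n in x0 x1 *.
have -> : m * c * (x ^+ 1 * kappa 1) = c * x.
  by transitivity (c * x * (m * kappa 1)); [ring|rewrite kappa1 mulr1].
have x3 : x ^+ 3 <= x ^+ 2 by rewrite exprS ler_piMl// exprn_ge0// ltW.
have x4 : x ^+ 4 <= x ^+ 2 by rewrite exprS (le_trans _ x3)// ler_piMl// exprn_ge0// ltW.
have x2 : 0 <= x ^+ 2 by rewrite exprn_ge0// ltW.
have bc : 0 <= b * c ^+ 2 by rewrite mulr_ge0// exprn_ge0// ltW.
have h3 : b * c ^+ 2 * kappa 3 * x ^+ 3 <= b * c ^+ 2 * kappa 3 * x ^+ 2.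
  by apply: ler_wpM2l => //; rewrite mulr_ge0.
have h4 : b * c ^+ 2 * kappa 4 * x ^+ 4 <= b * c ^+ 2 * kappa 4 * x ^+ 2.
  by apply: ler_wpM2l => //; rewrite mulr_ge0.
have : c * x ^+ 2 * (c * (b * D)) <= c * x ^+ 2 * (m * kappa 2 - 1).
  by apply: ler_wpM2l => //; rewrite mulr_ge0// ltW.
rewrite /D; lra.
Qed.

(** * Convergence for a nearly right-continuous walk *)

Section right_range.
Variable r : nat.
Hypothesis range_r : forall k : int, r%:Z < k -> a [set k] = 0%E.

(** The solution of [m * A * kappa 2 = A + b * kappa 2]: the surplus of the term [A * decay ^+ 2]
    pays exactly for the quadratic loss in [G]. *)
Let A := b * kappa 2 / (m * kappa 2 - 1).

Let A_ge0 : 0 <= A.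
Proof.
rewrite divr_ge0 ?subr_ge0 ?(ltW mkappa2_gt1)// mulr_ge0//.
by apply: mean_ge0 => y; rewrite exprn_ge0// exprz_ge0// ltW.
Qed.

Let A_gap : m * A * kappa 2 = A + b * kappa 2.
Proof.
rewrite /A; have := mkappa2_gt1; move: (kappa 2) => k k1.
by field; rewrite subr_eq0 gt_eqF.
Qed.

(** Since [u <= decay], the loss is at most [b * decay ^+ 2] in mean, so the left side is a
    subsolution past [N]. A window of [r] points suffices as initial data because no jump exceeds
    [r]. *)
Lemma solution_ge_window (N : int) (s : R) : 0 <= N ->
  (forall n, N - r%:Z < n <= N -> s * decay n + A * decay n ^+ 2 <= u n) ->
  forall n, N - r%:Z < n -> s * decay n + A * decay n ^+ 2 <= u n.
Proof.
move=> N0 uN n Nn; rewrite -subr_le0; move: n Nn.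
(* To the right of the window's left edge [decay] is at most [C], which yields the upper bound
   required by [comparison_window]. *)
set C := decay (N - r%:Z).
apply: (@comparison_window _ a m m_bounds _ _ _ (`|s| * C + A * C ^+ 2) range_r).
- move=> n Nn; have /andP[u0 _] := u01 n; have x0 := decay_gt0 n.
  have xC : decay n <= C by apply: decay_le; exact: ltW.
  rewrite lerBlDr ler_wpDr// lerD//.
    apply: (@le_trans _ _ (`|s| * decay n)); first by rewrite ler_pM2r// ler_norm.
    by rewrite ler_wpM2l.
  by rewrite ler_wpM2l// lerXn2r ?nnegrE ?(ltW (decay_gt0 _))//.
- by move=> n Nn; rewrite subr_le0 uN.
move=> n Nn; have n0 : 0 < n by exact: le_lt_trans Nn.
have sd i := summable_decay n i.
have su : summable_fun a (fun y => u (n - y)) by exact: summable_unit.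
have su2 : summable_fun a (fun y => u (n - y) ^+ 2).
  apply: (@summable_unit (fun n => u n ^+ 2)) => k.
  by have /andP[uk0 uk1] := u01 k; rewrite exprn_ge0// exprn_ile1.
have uge : m * E (fun y => u (n - y)) - b * (decay n ^+ 2 * kappa 2) <= u n.
  rewrite uE// -mean_decay -!meanZ// -meanB; [|exact: summableZ..].
  apply: le_mean => [||y]; [by apply: summableB; exact: summableZ|exact: summable_G|].
  have /andP[uy0 uy1] := u01 (n - y).
  have {2}-> : u (n - y) = Num.min 1 (u (n - y)) by rewrite minElt ltNge uy1.
  apply: le_trans (G_ge uy0); rewrite lerD2l lerN2 ler_wpM2l//.
  by rewrite ler_sqr ?nnegrE ?solution_le_decay// ltW// decay_gt0.
pose V (k : int) := s * decay k + A * decay k ^+ 2 - u k.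
have EV : E (fun y => V (n - y)) =
    s * E (fun y => decay (n - y)) + A * (decay n ^+ 2 * kappa 2) - E (fun y => u (n - y)).
  rewrite -mean_decay -!meanZ//; last exact: summable_decay1.
  have s1 := summable_decay1 n.
  rewrite meanB//; last by apply: summableD; exact: summableZ.
  by rewrite meanD//; exact: summableZ.
have sV : summable_fun a (fun y => V (n - y)).
  apply: summableB => //; apply: summableD; apply: summableZ => //.
  exact: summable_decay1.
apply: (@le_trans _ _ (m * E (fun y => V (n - y)))); last first.
  rewrite ler_pM2l//; apply: le_mean => // [|y]; last by rewrite le_max lexx orbT.
  apply: (summable_dom int_discrete (g := fun y => `|V (n - y)|)).
    exact: (integrable_norm sV).
  by move=> y; rewrite ger0_norm ?le_max ?lexx// ge_max normr_ge0 ler_norm.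
rewrite EV mulrBr mulrDr (mulrCA m s) mean_decay1.
have -> : m * (A * (decay n ^+ 2 * kappa 2)) = decay n ^+ 2 * (m * A * kappa 2) by ring.
rewrite A_gap; lra.
Qed.

Hypothesis r_gt0 : (0 < r)%N.
Hypothesis nearly_cont : forall i : nat, (1 <= i <= r)%N -> (0 < a [set i%:Z])%E.

Let h (n : nat) : R := rho ^+ n * u n%:Z.

Let decay_rho (n : nat) : decay n%:Z * rho ^+ n = 1.
Proof. by rewrite /decay -invr_expz mulVf// expf_neq0. Qed.

Let uh (n : nat) : u n%:Z = h n * decay n%:Z.
Proof. by rewrite /h mulrAC mulrC (mulrC (rho ^+ n)) decay_rho mulr1. Qed.

Let h_ge0 n : 0 <= h n.
Proof. by rewrite mulr_ge0// ?exprn_ge0 ?(ltW rho_gt0)//; case/andP: (u01 n%:Z). Qed.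

Let h_le1 n : h n <= 1.
Proof.
rewrite -(decay_rho n) /h mulrC ler_pM2r ?exprn_gt0//.
exact: solution_le_decay.
Qed.

(* If h almost attains its limsup at n, the equation for u n forces it to be
   almost as large at all the points n - i charged by the jump law. *)
Lemma oscillation_step (H s alpha : R) (N n : nat) :
  (forall k, (N <= k)%N -> h k <= H) -> (N + r <= n)%N -> (0 < n)%N -> s <= h n ->
  (forall i : nat, (1 <= i <= r)%N -> alpha <= m * fine (a [set i%:Z]) * rho ^+ i) ->
  forall i : nat, (1 <= i <= r)%N -> alpha * (H - h (n - i)) <= H - s.
Proof.
move=> hH Nn n0 sn ali i ir.
pose D := u (n%:Z - i%:Z) - H * decay (n%:Z - i%:Z).
have s1 := summable_decay1 n%:Z.
have sind : summable_fun a (fun y => (y \in [set i%:Z])%:R : R).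
  apply: (@summable_bounded _ _ _ a int_discrete _ 1) => y.
  by case: (_ \in _); rewrite ?normr1 ?normr0.
(* Every value of [u] is bounded by [H * decay] except the one at [n - i], which is kept exactly
   through [D]. *)
have E1 : u n%:Z <= m * (H * E (fun y => decay (n%:Z - y)) + D * fine (a [set i%:Z])).
  apply: (le_trans (solution_subsolution _)) => //; rewrite ler_pM2l//.
  rewrite -(mean_indic a int_discrete) -!meanZ// -meanD; [|exact: summableZ..].
  (* Jumps beyond [r] would lead below [N], where [h <= H] may fail; they are null, so the integrand
     is set to 0 there. *)
  rewrite (@eq_mean_ae _ _ _ a int_discrete (fun y => u (n%:Z - y))
    (fun y => if y <= r%:Z then u (n%:Z - y) else 0) [set y | y <= r%:Z]).
  - apply: le_mean => [||y].
    + apply: (@summable_bounded _ _ _ a int_discrete _ 1) => y.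
      have /andP[uy0 uy1] := u01 (n%:Z - y).
      by case: ifP; rewrite ?normr0// ger0_norm.
    + by apply: summableD; exact: summableZ.
    + have H0 : 0 <= H by apply: le_trans (hH N (leqnn _)).
      have [->|yi] := eqVneq y i%:Z.
        rewrite mem_set// mulr1 ifT; last by rewrite lez_nat; case/andP: ir.
        by rewrite /D [leRHS]addrC subrK.
      rewrite memNset ?mulr0 ?addr0; last by apply/eqP.
      case: ifP => yr; last by rewrite mulr_ge0// ltW// decay_gt0.
      have [-> Ny] : n%:Z - y = `|n%:Z - y|%N :> int /\ (N <= `|n%:Z - y|)%N.
        by clear - yr Nn; lia.
      by rewrite uh ler_pM2r ?decay_gt0//; exact: hH.
  - exact: null_above range_r.
  - by move=> y /= ->.
move: E1; rewrite mulrDr mulrCA mean_decay1.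
have uhi : D = (h (n - i) - H) * decay n%:Z * rho ^+ i.
  have ni : n%:Z - i%:Z = (n - i)%N%:Z by clear - Nn ir; lia.
  by rewrite /D ni uh -mulrBl -mulrA; congr (_ * _); rewrite -ni decayB.
rewrite uhi uh => E1.
have x0 := decay_gt0 n%:Z.
have {}E1 : h n <= H - (H - h (n - i)) * (m * fine (a [set i%:Z]) * rho ^+ i).
  rewrite -(ler_pM2r x0); apply: (le_trans E1); rewrite le_eqVlt; apply/orP; left.
  by apply/eqP; ring.
have hi : 0 <= H - h (n - i).
  by rewrite subr_ge0 hH//; clear - Nn ir; lia.
have := ler_wpM2l hi (ali i ir); lra.
Qed.

(** The limsup as the infimum of the eventual upper bounds, which lets [inf_adherent] and [ge_inf]
    give its two characteristic properties. *)
Let limsup_h : R := inf [set s | exists N, forall n, (N <= n)%N -> h n <= s].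

Let has_inf_h : has_inf [set s | exists N, forall n, (N <= n)%N -> h n <= s].
Proof.
split; first by exists 1, 0%N => n _; exact: h_le1.
by exists 0 => s [N /(_ N (leqnn _))]; exact: le_trans.
Qed.

Let limsup_h_above e : 0 < e -> exists N, forall n, (N <= n)%N -> h n <= limsup_h + e.
Proof.
move=> e0; have [s [N hs] sH] := inf_adherent e0 has_inf_h.
by exists N => n /hs /le_trans; apply; exact: ltW.
Qed.

Let limsup_h_frequent e N : 0 < e -> exists2 n, (N <= n)%N & limsup_h - e <= h n.
Proof.
move=> e0; apply: contrapT => no.
suff : limsup_h <= limsup_h - e by lra.
apply: ge_inf; first by case: has_inf_h.
exists N => n Nn; apply: contrapT => /negP; rewrite -ltNge => hn.
by apply: no; exists n => //; exact: ltW.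
Qed.

(** A nearly maximal value at a late [n] spreads to the [r] preceding points by [oscillation_step];
    [solution_ge_window] then carries the bound to all later points. *)
Let limsup_h_below e : 0 < e -> exists N, forall n, (N <= n)%N -> limsup_h - e <= h n.
Proof.
move=> e0.
have [|alpha alpha0 ali] := @positive_lower_bound _
    (fun i => m * fine (a [set i%:Z]) * rho ^+ i) r.
  move=> i ir; rewrite mulr_gt0 ?exprn_gt0// mulr_gt0// fine_gt0//.
  rewrite nearly_cont//=; apply: (le_lt_trans (probability_le1 a _)) => //.
  by rewrite ltry.
pose delta := Num.min 1 (alpha) * e / 4.
have d0 : 0 < delta by rewrite divr_gt0// mulr_gt0// lt_min ltr01.
have de : 2 * delta <= alpha * (e / 2).
  have : Num.min 1 alpha * e <= alpha * e by rewrite ler_pM2r// ge_min lexx orbT.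
  by rewrite /delta; lra.
have [N hN] := limsup_h_above d0.
have dec0 : exists K, forall k, (K <= k)%N -> A * decay k%:Z <= e / 2.
  have cv : (fun k : nat => A * decay k%:Z) @ \oo --> (0 : R).
    rewrite -[X in _ --> X](mulr0 A); apply: cvgMr.
    rewrite (_ : (fun k : nat => decay k%:Z) = (fun k : nat => rho^-1 ^+ k)).
      apply: cvg_expr; rewrite ger0_norm ?invf_lt1//.
      by rewrite invr_ge0 ltW.
    by apply/funext => k; rewrite /decay -invr_expz exprVn.
  have e2 : 0 < e / 2 by rewrite divr_gt0.
  have /cvgrPdist_le/(_ _ e2)[K _ hK] := cv.
  exists K => k /hK /=; rewrite sub0r normrN; apply: le_trans; exact: ler_norm.
have [K hK] := dec0.
have [n nN hn] := limsup_h_frequent (maxn N K + r).+1 d0.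
have [[Nle Kle] n0] : ((N + r <= n)%N /\ (K + r <= n)%N) /\ (0 < n)%N.
  by clear - nN; lia.
have osc := oscillation_step hN Nle n0 hn ali.
exists n => k nk.
suff : (limsup_h - e) * decay k%:Z + A * decay k%:Z ^+ 2 <= u k%:Z.
  rewrite uh => hk; rewrite -(ler_pM2r (decay_gt0 k%:Z)); apply: le_trans hk.
  by rewrite lerDl mulr_ge0// exprn_ge0// ltW// decay_gt0.
(* Ending the window at [n - 1] makes it the set of points [n - i] with [1 <= i <= r]. *)
apply: (@solution_ge_window n.-1%:Z); [by []| |by clear - r_gt0 n0 nk; lia].
move=> j jn.
pose i := `|n%:Z - j|%N.
have [[ji ir] ni] : (j = (n - i)%N%:Z /\ (1 <= i <= r)%N) /\ (K <= n - i)%N.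
  by rewrite /i; clear - jn n0 Kle; lia.
rewrite ji uh expr2 mulrA -mulrDl ler_pM2r ?decay_gt0//.
have := hK _ ni; have := osc i ir.
move: (h (n - i)) (decay _) => hi x oi Ax.
have : alpha * (limsup_h + delta - hi) <= alpha * (e / 2) by lra.
by rewrite ler_pM2l//; lra.
Qed.

Theorem solution_cvg : exists2 H : R, 0 < H <= 1 & h @ \oo --> H.
Proof.
have cv : h @ \oo --> limsup_h by exact: cvg_from_below.
have [c c0 hc] := solution_ge_decay.
exists limsup_h => //; rewrite -(cvg_lim _ cv)//.
have cvh : cvgn h by apply/cvg_ex; exists limsup_h.
apply/andP; split; last by apply: limr_le => //; exact: nearW.
apply: (lt_le_trans c0); apply: limr_ge => //; apply: nearW => n.
by rewrite -(ler_pM2r (decay_gt0 n%:Z)) -uh hc.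
Qed.

End right_range.

End nonlinear.
End renewal_equation.

(** * The tree as a functional of its labels *)

Section disintegration.
Local Open Scope ereal_scope.
Context {d dS} {T : measurableType d} {S : measurableType dS} {R : realType}.
Variables (nu : probability T R) (mu : probability S R).

(** Total probability over the countably many values of [Y], enumerated by the injection [f]. The
    constant [c] carries the mass of a value fixed beforehand, so that conditionings can be
    nested. *)
Lemma disintegration (f : S -> nat) (Y : T -> S) (E : set T) (c : R) (h : S -> R) :
  injective f -> (forall A : set S, measurable A) -> measurable E ->
  (forall y, measurable (Y @^-1` [set y])) -> (0 <= c)%R ->
  (forall y, (0 <= h y)%R) ->
  (forall y, nu (E `&` Y @^-1` [set y]) = c%:E * (mu [set y] * (h y)%:E)) ->
  nu E = c%:E * \int[mu]_y (h y)%:E.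
Proof.
move=> injf dS' mE mY c0 h0 nuE.
pose F n := f @^-1` [set n].
have F01 n : F n = set0 \/ exists y, F n = [set y].
  have [[y fy]|nf] := pselect (exists y, f y = n).
    right; exists y; apply/seteqP; split => [z /= fz|_ -> //].
    by apply: injf; rewrite fz.
  by left; apply/seteqP; split => // y fy; apply: nf; exists y.
have tF : trivIset setT F by move=> i j _ _ [y [<- <-]].
have FT : \bigcup_n F n = setT by apply/seteqP; split => // y _; exists (f y).
have mYF n : measurable (E `&` Y @^-1` F n).
  by apply: measurableI => //; case: (F01 n) => [|[y]] ->; rewrite ?preimage_set0.
have -> : nu E = \sum_(n <oo) nu (E `&` Y @^-1` F n).
  rewrite -measure_semi_bigcup//.
  - by rewrite -setI_bigcupr -preimage_bigcup FT preimage_setT setIT.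
  - by move=> i j _ _ [t [[_ Fi] [_ Fj]]]; apply: tF => //; exists (Y t).
  - exact: bigcup_measurable.
have -> : \int[mu]_y (h y)%:E = \sum_(n <oo) \int[mu]_(y in F n) (h y)%:E.
  rewrite -FT ge0_integral_bigcup//.
  by move=> y _; rewrite lee_fin.
rewrite -nneseriesZl; last first.
  by move=> n _; apply: integral_ge0 => y _; rewrite lee_fin.
apply: eq_eseriesr => n _; case: (F01 n) => [|[y]] ->.
  by rewrite preimage_set0 setI0 measure0 integral_set0 mule0.
rewrite nuE (eq_integral (cst (h y)%:E)); last by move=> x /[!inE] ->.
by rewrite integral_cst// (muleC (mu _)).
Qed.

End disintegration.

Section tree.
Context {R : realType}.

Local Notation T := (int * nat)%type.

(** The tree is read off a deterministic configuration, so that its events are sets of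
    configurations on which a product law acts. *)
Definition in_tree_of (z : seq nat -> T) (v : seq nat) : Prop :=
  forall k, (k < size v)%N -> (nth 0 v k < (z (take k v)).2)%N.

Definition position_of (z : seq nat -> T) (v : seq nat) : int :=
  \sum_(k < size v) (z (take k v)).1.

Definition visits (v : seq nat) (j : int) : set (seq nat -> T) :=
  [set z | in_tree_of z v /\ j <= position_of z v].

Definition reach (j : int) : set (seq nat -> T) := \bigcup_v visits v j.

Local Notation sub := (fun (i : nat) => reindex (cons i)).
Local Notation cyl := (@cylinders (seq nat) _ T).

Lemma in_tree_of_cons i v z :
  in_tree_of z (i :: v) <-> (i < (z [::]).2)%N /\ in_tree_of (sub i z) v.
Proof.
split=> [tr|[i0 tr] [|k]//= kv]; last exact: tr.
by split=> [|k kv]; [exact: (tr 0%N)|exact: (tr k.+1)].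
Qed.

Lemma position_of_cons i v z :
  position_of z (i :: v) = (z [::]).1 + position_of (sub i z) v.
Proof. by rewrite /position_of big_ord_recl /=. Qed.

Lemma visits_cons i v j : visits (i :: v) j =
  \bigcup_y ([set z | (z [::]).1 = y /\ (i < (z [::]).2)%N] `&`
             sub i @^-1` visits v (j - y)).
Proof.
apply/seteqP; split => [z [/in_tree_of_cons[iz tz]]|z [y _ [[zy iz] [tz]]]].
  rewrite position_of_cons => jz; exists (z [::]).1 => //; split=> //.
  by split=> //; rewrite lerBlDl.
rewrite -zy lerBlDl => jz; split; first exact/in_tree_of_cons.
by rewrite position_of_cons.
Qed.

Lemma cons_inj (i : nat) : injective (cons i). Proof. by move=> v w []. Qed.

Lemma measurable_pair (A : set T) : measurable A.
Proof.
apply: countable_measurable; last exact: countableP.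
move=> [y k]; rewrite (_ : [set (y, k)] = [set y] `*` [set k]).
  exact: measurableX.
by apply/seteqP; split => [_ ->|[y' k'] [/= -> ->]].
Qed.

Lemma measurable_visits v j : <<s cyl setT >> (visits v j).
Proof.
elim: v j => [|i v IH] j.
  have [j0|j0] := leP j 0.
    rewrite (_ : visits [::] j = setT).
      exact: (@measurableT _ (config (I := seq nat) (T := T))).
    apply/seteqP; split => // z _; split=> //.
    by rewrite /position_of big_ord0.
  rewrite (_ : visits [::] j = set0).
    exact: (@measurable0 _ (config (I := seq nat) (T := T))).
  apply/seteqP; split => // z [_]; rewrite /position_of big_ord0.
  by rewrite leNgt j0.
rewrite visits_cons.
apply: (@countable_bigcupT_measurable _ (config (I := seq nat) (T := T))).
  exact: countableP.
move=> y; apply: (@measurableI _ (config (I := seq nat) (T := T))).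
  apply: (@cylinders_coord _ _ _ setT [::]
    [set t : T | t.1 = y /\ (i < t.2)%N]) => //.
  exact: measurable_pair.
by apply: reindex_cylinders => //; exact: cons_inj.
Qed.

Lemma measurable_reach j : <<s cyl setT >> (reach j).
Proof.
apply: (@countable_bigcupT_measurable _ (config (I := seq nat) (T := T))).
  exact: countableP.
by move=> v; exact: measurable_visits.
Qed.

Lemma reach_le0 j : j <= 0 -> reach j = setT.
Proof.
move=> j0; apply/seteqP; split => // z _; exists [::] => //; split=> //.
by rewrite /position_of big_ord0.
Qed.

(* None of the first [k] subtrees of the root reaches [j]. *)
Definition extinct (k : nat) (j : int) : set (seq nat -> T) :=
  [set z | forall i, (i < k)%N -> ~ reach j (sub i z)].

(** The root sits at 0 and cannot reach [j > 0] by itself; its children start at [y], so each of the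
    [k] subtrees must miss the remaining height [j - y]. *)
Lemma reachC j y k : 0 < j ->
  ~` reach j `&` [set z | z [::] = (y, k)] =
  [set z | z [::] = (y, k)] `&` extinct k (j - y).
Proof.
move=> j0; apply/seteqP; split => [z [nr zy]|z [zy ex]].
  split=> // i ik [v _ [tz jz]]; apply: nr; exists (i :: v) => //; split.
    by apply/in_tree_of_cons; rewrite zy.
  by rewrite position_of_cons zy/= -lerBlDl.
split=> // -[[|i v] _ [tz]].
  by rewrite /position_of big_ord0 leNgt j0.
move: tz => /in_tree_of_cons[]; rewrite zy/= => ik tz.
rewrite position_of_cons zy/= -lerBlDl => jz.
by apply: (ex i ik); exists v.
Qed.

Variables (mu : probability T R).
Variable nu : probability (config (I := seq nat) (T := T)) R.
Hypothesis nuE : is_product_law mu nu.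

(** By induction on [k]: subtree [k] uses only labels beginning with [k], hence is independent of
    the root and of the earlier subtrees, and it has the law of the whole tree. *)
Lemma law_extinct (t : T) k j :
  nu ([set z | z [::] = t] `&` extinct k j) =
  (mu [set t] * ((1 - fine (nu (reach j))) ^+ k)%:E)%E.
Proof.
(* The labels of the root and of its first [k] subtrees. *)
pose D k := [set v : seq nat | v = [::] \/ exists2 i, (i < k)%N & exists w, v = i :: w].
have mroot k' : <<s cyl (D k') >> [set z | z [::] = t].
  by apply: (@cylinders_coord _ _ _ (D k') [::] [set t]); [left|exact: measurable_pair].
have mext k' : <<s cyl (D k') >> ([set z | z [::] = t] `&` extinct k' j).
  have -> : extinct k' j = \bigcap_(i in `I_k') (sub i @^-1` (~` reach j)).
    by apply/seteqP; split => z ez i ik; exact: ez.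
  apply: (@measurableI _ (g_sigma_algebraType (cyl (D k')))); first exact: mroot.
  apply: (@bigcap_measurableType _ (g_sigma_algebraType (cyl (D k')))) => i ik.
  apply: reindex_cylinders; first exact: cons_inj.
    by move=> _ [w _ <-]; right; exists i => //; exists w.
  apply: (@measurableC _ (config (I := seq nat) (T := T))).
  exact: measurable_reach.
have nroot : nu [set z | z [::] = t] = mu [set t].
  have := @nuE [fset [::]]%fset (fun=> [set t]) (fun=> measurable_pair _).
  rewrite big_seq_fset1 => <-; congr (nu _); apply/seteqP; split => z zt.
    by move=> i; rewrite inE => /eqP ->.
  by apply: zt; rewrite inE.
elim: k => [|k IH].
  rewrite expr0 mule1 -nroot; congr (nu _).
  by apply/seteqP; split => z; [case|split].
have -> : [set z | z [::] = t] `&` extinct k.+1 j =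
    ([set z | z [::] = t] `&` extinct k j) `&` (sub k @^-1` (~` reach j)).
  apply/seteqP; split => [z [zt ez]|z [[zt ez] rz]].
    by split; [split=> // i ik; apply: ez; exact: ltnW|exact: ez].
  split=> // i; rewrite ltnS leq_eqVlt => /orP[/eqP ->//|]; exact: ez.
have mC : <<s cyl setT >> (~` reach j).
  apply: (@measurableC _ (config (I := seq nat) (T := T))).
  exact: measurable_reach.
rewrite (@product_law_indep _ _ _ _ mu nu nuE (D k) [set v | exists w, v = k :: w]).
- rewrite (product_law_reindex nuE)//; last exact: cons_inj.
  rewrite [X in (_ * X)%E](_ : _ = (1 - fine (nu (reach j)))%:E).
    by rewrite IH -muleA -EFinM exprSr.
  rewrite EFinB fineK; last by apply: fin_num_measure; exact: measurable_reach.
  by apply: probability_setC; exact: measurable_reach.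
- apply/seteqP; split => // v [[->|[i ik [w ->]]] [w' //]] [ik' _].
  by rewrite ik' ltnn in ik.
- exact: mext.
- apply: reindex_cylinders => //; first exact: cons_inj.
  by move=> _ [w _ <-]; exists w.
Qed.

End tree.

(** * Equation for the reach probability *)

Section offspring.
Context {R : realType}.
Variable p : probability nat R.

Let nat_discrete (A : set nat) : measurable A. Proof. by []. Qed.

(* The probability that, of a random number of independent trials with success
   probability [s], at least one succeeds. *)
Definition survival (s : R) : R := mean p (fun k => 1 - (1 - s) ^+ k).

Let m : R := mean p (fun k => k%:R).
Let b : R := mean p (fun k => k%:R ^+ 2).

Hypothesis summable1 : summable_fun p (fun k => k%:R).
Hypothesis summable2 : summable_fun p (fun k => k%:R ^+ 2).

Let survival_term (s : R) k : 0 <= s <= 1 -> 0 <= 1 - (1 - s) ^+ k <= 1.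
Proof.
move=> s01; have s0 : 0 <= 1 - s by lra.
have s1 : 1 - s <= 1 by lra.
by have := exprn_ge0 k s0; have := exprn_ile1 k s0 s1; lra.
Qed.

Lemma summable_pow (s : R) : 0 <= s <= 1 -> summable_fun p (fun k => (1 - s) ^+ k).
Proof.
move=> s01; apply: (@summable_bounded _ _ _ p nat_discrete _ 1) => k.
by have := survival_term k s01; rewrite ler_norml; lra.
Qed.

Let summable_term (s : R) : 0 <= s <= 1 -> summable_fun p (fun k => 1 - (1 - s) ^+ k).
Proof. by move=> s01; apply: summableB; [exact: summable_cst|exact: summable_pow]. Qed.

Lemma survivalE s : 0 <= s <= 1 -> survival s = 1 - mean p (fun k => (1 - s) ^+ k).
Proof.
move=> s01; rewrite /survival meanB ?mean_cst//; first exact: summable_cst.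
exact: summable_pow.
Qed.

Lemma survival0 : survival 0 = 0.
Proof. by rewrite survivalE ?lexx ?ler01// subr0 (eq_mean p (expr1n _)) mean_cst subrr. Qed.

Lemma survival_bounds s : 0 <= s <= 1 -> 0 <= survival s <= 1.
Proof.
move=> s01; apply/andP; split.
  by apply: mean_ge0 => k; case/andP: (survival_term k s01).
rewrite -[leRHS](mean_cst p); apply: le_mean => [||k]; first exact: summable_term.
  exact: summable_cst.
by case/andP: (survival_term k s01).
Qed.

Lemma ler_subX (x y : R) k : 0 <= y -> y <= x -> x <= 1 ->
  x ^+ k - y ^+ k <= k%:R * (x - y).
Proof.
move=> y0 yx x1; elim: k => [|k IH]; first by rewrite !expr0 mul0r subrr.
have x0 : 0 <= x by exact: le_trans yx.
have yk0 := exprn_ge0 k y0; have yk1 := exprn_ile1 k y0 (le_trans yx x1).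
have -> : x ^+ k.+1 - y ^+ k.+1 = x * (x ^+ k - y ^+ k) + (x - y) * y ^+ k.
  by rewrite !exprS; ring.
rewrite -natr1 [leRHS]mulrDl mul1r lerD//.
  apply: le_trans IH; apply: ler_piMl => //.
  by rewrite subr_ge0 lerXn2r.
by rewrite ler_piMr// subr_ge0.
Qed.

(** Monotonicity handles [s <= t]; otherwise the bound [k * (s - t)] for [k] offspring averages to
    the constant [m]. *)
Lemma survival_lip s t : 0 <= s <= 1 -> 0 <= t <= 1 ->
  survival s <= survival t + m * Num.max 0 (s - t).
Proof.
move=> s01 t01; rewrite mulrC -meanZ// -meanD//; last first.
- exact: summableZ.
- exact: summable_term.
apply: le_mean => [||k]; first exact: summable_term.
  by apply: summableD; [exact: summable_term|exact: summableZ].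
have [st|ts] := leP s t.
  have -> : Num.max 0 (s - t) = 0 by apply/max_idPl; lra.
  rewrite mul0r addr0 lerD2l lerN2 lerXn2r ?nnegrE; lra.
have -> : Num.max 0 (s - t) = s - t by apply/max_idPr; lra.
have := @ler_subX (1 - t) (1 - s) k.
have -> : 1 - t - (1 - s) = s - t by ring.
move=> h; have {}h : (1 - t) ^+ k - (1 - s) ^+ k <= k%:R * (s - t).
  by apply: h; lra.
by rewrite (mulrC (s - t)); lra.
Qed.

(** A Bonferroni bound of second order, with the binomial coefficient relaxed to [k ^ 2]. *)
Lemma pow_le_quadratic (t : R) k : 0 <= t <= 1 ->
  (1 - t) ^+ k <= 1 - k%:R * t + k%:R ^+ 2 * t ^+ 2.
Proof.
move=> t01; elim: k => [|k IH]; first by rewrite expr0 expr0n/= !mul0r subr0 addr0.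
rewrite exprS -natr1.
have t0 : 0 <= 1 - t by lra.
apply: (le_trans (ler_wpM2l t0 IH)).
have k0 : 0 <= (k%:R : R) by [].
move: (k%:R) k0 => x x0.
have : 0 <= x ^+ 2 * t ^+ 3 by rewrite mulr_ge0// exprn_ge0//; lra.
have : 0 <= x * t ^+ 2 by rewrite mulr_ge0// exprn_ge0//; lra.
have : 0 <= t ^+ 2 by rewrite exprn_ge0//; lra.
by move=> h1 h2 h3; lra.
Qed.

Lemma survival_ge t : 0 <= t -> m * t - b * t ^+ 2 <= survival (Num.min 1 t).
Proof.
move=> t0; rewrite mulrC [X in _ - X]mulrC -!meanZ// -meanB//; last first.
- exact: summableZ.
- exact: summableZ.
apply: le_mean => [||k]; first by apply: summableB; exact: summableZ.
  by apply: summable_term; rewrite le_min t0 ler01 ge_min lexx.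
(* For [t < 1] the quadratic bound applies. For [t >= 1] the left side is nonpositive term by term,
   since [k * t >= 1] whenever [k >= 1]. *)
have [t1|t1] := leP 1 t; last first.
  have := @pow_le_quadratic t k; rewrite t0 (ltW t1) => /(_ isT).
  by rewrite (mulrC (t ^+ 2)) (mulrC t); lra.
case: k => [|k]; first by rewrite expr0 subrr expr0n/= !mulr0 subrr.
rewrite subrr expr0n/= subr0; apply: (@le_trans _ _ 0); last exact: ler01.
rewrite subr_le0 -exprMn; set x := t * _.
have x1 : 1 <= x by rewrite /x mulr_ege1// ler1n.
by rewrite expr2 ler_peMl// (le_trans ler01).
Qed.

End offspring.

Section reach_equation.
Context {R : realType}.
Local Notation T := (int * nat)%type.
Variables (a : probability int R) (p : probability nat R) (mu : probability T R).
Variable nu : probability (config (I := seq nat) (T := T)) R.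
Hypothesis nuE : is_product_law mu nu.
Hypothesis muE : forall y k, mu [set (y, k)] = (a [set y] * p [set k])%E.

Let u (j : int) : R := fine (nu (reach j)).

Let fin_num_nu E : <<s @cylinders _ _ T setT >> E -> nu E \is a fin_num.
Proof. by move=> sE; apply: fin_num_measure. Qed.

Lemma reach_prob01 j : 0 <= u j <= 1.
Proof.
have mr := measurable_reach j.
rewrite -2!lee_fin /u fineK ?fin_num_nu// measure_ge0/=.
exact: (probability_le1 nu mr).
Qed.

Lemma reach_prob_le0 j : j <= 0 -> u j = 1.
Proof. by move=> j0; rewrite /u reach_le0// probability_setT. Qed.

(** The complement is disintegrated twice: over the offspring number for a fixed root jump ([step]),
    then over the root jump ([nuC]). *)
Lemma reach_equation j : 0 < j -> u j = mean a (fun y => survival p (u (j - y))).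
Proof.
move=> j0.
pose h y := mean p (fun k => (1 - u (j - y)) ^+ k).
have u01' y : 0 <= 1 - u (j - y) by have := reach_prob01 (j - y); lra.
have h0 y : 0 <= h y by apply: mean_ge0 => k; rewrite exprn_ge0.
have mroot (A : set T) : @measurable _ (config (I := seq nat) (T := T)) [set z | A (z [::])].
  by apply: cylinders_coord => //; exact: measurable_pair.
have mC : @measurable _ (config (I := seq nat) (T := T)) (~` reach j).
  by apply: measurableC; exact: measurable_reach.
have step y : nu (~` reach j `&` [set z | (z [::]).1 = y]) = (a [set y] * (h y)%:E)%E.
  have af : a [set y] \is a fin_num by exact: fin_num_measure.
  rewrite (@disintegration _ _ _ _ _ nu p id (fun z => (z [::]).2) _
    (fine (a [set y])) (fun k => (1 - u (j - y)) ^+ k)) => //.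
  - by rewrite fineK// EFin_mean//; exact: summable_pow (reach_prob01 _).
  - by apply: measurableI => //; exact: mroot [set t | t.1 = y].
  - by move=> k; exact: mroot [set t | t.2 = k].
  - by rewrite fine_ge0.
  - by move=> k; rewrite exprn_ge0.
  move=> k; rewrite fineK// muleA -muE -law_extinct//.
  rewrite -reachC// -setIA; congr (nu (_ `&` _)).
  by apply/seteqP; split => z /=; [case: (z [::]) => y' k' /= [-> ->]|move=> ->].
have nuC : (nu (~` reach j) = (mean a h)%:E)%E.
  rewrite (@disintegration _ _ _ _ _ nu a (@choice.pickle int) (fun z => (z [::]).1) _ 1 h) => //.
  - rewrite mul1e EFin_mean//.
    apply: (@summable_bounded _ _ _ a _ _ 1) => // y; rewrite ger0_norm//.
    have := survival_bounds p (reach_prob01 (j - y)).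
    by rewrite survivalE ?reach_prob01//; rewrite -/(h y); lra.
  - by move=> y; exact: mroot [set t | t.1 = y].
  - by move=> y; rewrite mul1e step.
have mr := measurable_reach j.
have : nu (~` reach j) = (1 - (u j)%:E)%E.
  by rewrite /u fineK ?fin_num_nu//; exact: probability_setC.
rewrite nuC => -[hu].
have sh : summable_fun a h.
  apply: (@summable_bounded _ _ _ a _ _ 1) => // y; rewrite ger0_norm//.
  have := survival_bounds p (reach_prob01 (j - y)).
  by rewrite survivalE ?reach_prob01//; rewrite -/(h y); lra.
rewrite (@eq_mean _ _ _ a _ (fun y => 1 - h y)); last first.
  by move=> y; rewrite survivalE ?reach_prob01.
by rewrite meanB// ?mean_cst ?hu; [lra|exact: summable_cst].
Qed.

End reach_equation.

(** * Laws of the branching random walk *)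

(** The joint law of an i.i.d. family is pushed forward to configuration space, where relabelling
    and independence are available. *)
Lemma independent_family_law {R : realType} {d} {Omega : measurableType d}
    (P : probability Omega R) {I : choiceType} {dT} {T : measurableType dT}
    (mu : probability T R) (X : I -> Omega -> T) :
  (forall i, measurable_fun setT (X i)) -> independent_family P X ->
  (forall i A, measurable A -> P (X i @^-1` A) = mu A) ->
  exists2 nu : probability (config (I := I) (T := T)) R, is_product_law mu nu &
    forall E, <<s cylinders setT >> E ->
      measurable [set w | E (X ^~ w)] /\ nu E = P [set w | E (X ^~ w)].
Proof.
move=> mX indX lawX.
pose Z (w : Omega) : config (I := I) (T := T) := X ^~ w.
have mpre i A : measurable A -> measurable (X i @^-1` A).
  by move=> mA; rewrite -[X in measurable X]setTI; exact: mX.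
have preZ J A : Z @^-1` cylinder J A = \bigcap_(i in [set` J]) (X i @^-1` A i).
  by apply/seteqP; split => w ZA i; exact: ZA.
have mZ : measurable_fun setT Z.
  apply: (@measurability _ _ Omega (config (I := I) (T := T)) setT Z (cylinders setT) erefl).
  move=> _ [_ [J [A [_ mA ->]]] <-]; rewrite setTI preZ.
  by apply: fin_bigcap_measurable => // i _; exact: mpre.
pose Zm : {mfun Omega >-> config (I := I) (T := T)} := mfun_Sub (mem_set mZ).
exists (distribution P Zm).
  move=> J A mA; rewrite -[LHS]/(P (Z @^-1` cylinder J A)) preZ indX//.
  by apply: eq_bigr => i _; exact: lawX.
move=> E sE; split => //.
by have := mZ measurableT E sE; rewrite setTI.
Qed.

Section brw_law.
Context {d} {Omega : measurableType d} {R : realType}.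
Variables (P : probability Omega R) (a : probability int R) (p : probability nat R).
Variables (xi : seq nat -> {RV P >-> int}) (N : seq nat -> {RV P >-> nat}).
Hypothesis brw : is_brw a p xi N.

Local Notation T := (int * nat)%type.
Let X (v : seq nat) (w : Omega) : T := (xi v w, N v w).

Let mX v : measurable_fun setT (X v).
Proof. by apply/measurable_fun_pairP; split; exact: measurable_funPT. Qed.

Let Xrect v (A : set int) (B : set nat) :
  P (X v @^-1` (A `*` B)) = (a A * p B)%E.
Proof.
rewrite -(brw_jump_law brw v)// -(brw_offspring_law brw v)//.
exact: (brw_jump_offspring_indep brw).
Qed.

Lemma brw_law : exists (mu : probability T R)
    (nu : probability (config (I := seq nat) (T := T)) R),
  [/\ is_product_law mu nu,
      forall y k, mu [set (y, k)] = (a [set y] * p [set k])%E &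
      forall n : nat, u xi N n = fine (nu (reach n%:Z))].
Proof.
pose X0 : {mfun Omega >-> T} := mfun_Sub (mem_set (mX [::])).
pose mu : probability T R := distribution P X0.
have lawX v A : measurable A -> P (X v @^-1` A) = mu A.
  move: A; apply: (@law_unique _ _ _ P _ _ mu (X v)
    [set A `*` B | A in measurable & B in measurable]) => //.
  - exact: measurable_prod_measurableType.
  - move=> _ _ [A _ [B _ <-]] [A' _ [B' _ <-]]; exists (A `&` A') => //.
    by exists (B `&` B') => //; rewrite setXI.
  - by move=> _ [A _ [B _ <-]]; rewrite Xrect; exact/esym/Xrect.
have [nu nuE nuP] := independent_family_law mX (brw_indep brw) lawX.
exists mu, nu; split=> //.
  move=> y k; rewrite -[RHS](Xrect [::]); congr (P _).
  by apply/seteqP; split => w [xy Nk]; [split|congr pair].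
move=> n; have [_ ->] := nuP _ (measurable_reach n%:Z); congr (fine (P _)).
apply/seteqP; split => [w /= nM|w /= [v _ [tv nv]]].
  (* A supremum need not be attained, so a particle strictly above [n - 1] is extracted; by
     integrality it is at or above [n]. *)
  have : ((n%:R - 1)%:E < M xi N w)%E.
    by apply: lt_le_trans nM; rewrite lte_fin ltrBlDr ltrDl.
  move=> /ereal_sup_gt[_ [k _ <-]] /ereal_sup_gt[_ [v [tv _] <-]].
  rewrite lte_fin ltrBlDr => nv; exists v => //; split=> //.
  by move: nv; rewrite -[1]/(1%:~R) -[n%:R]/(n%:Z%:~R) -intrD ltr_int ltzD1.
apply: (@le_trans _ _ (Mn xi N (size v) w)).
  apply: (@le_trans _ _ ((position xi v w)%:~R)%:E).
    by rewrite lee_fin -[n%:R]/(n%:Z%:~R) ler_int.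
  by apply: ereal_sup_ubound; exists v.
by apply: ereal_sup_ubound; exists (size v).
Qed.

End brw_law.

(** * First passage of the walk *)

Section first_passage.
Context {R : realType}.

Definition partial_sum (z : nat -> int) (n : nat) : int := \sum_(i < n) z i.

Definition first_passage (n : nat) (j : int) : set (nat -> int) :=
  [set z | j <= partial_sum z n /\ forall k, (k < n)%N -> partial_sum z k < j].

Lemma partial_sum0 z : partial_sum z 0 = 0.
Proof. by rewrite /partial_sum big_ord0. Qed.

Lemma partial_sumS z n :
  partial_sum z n.+1 = z 0%N + partial_sum (reindex succn z) n.
Proof. by rewrite /partial_sum big_ord_recl. Qed.

Lemma first_passage0 j : first_passage 0 j = if j <= 0 then setT else set0.
Proof.
apply/seteqP; split => z; rewrite /first_passage/= partial_sum0; case: ifP => //.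
  by move=> _ [].
Qed.

Lemma first_passageS_le0 n j : j <= 0 -> first_passage n.+1 j = set0.
Proof.
move=> j0; apply/seteqP; split => // z [_ /(_ 0%N isT)].
by rewrite partial_sum0 ltNge j0.
Qed.

Lemma first_passageS n j y : 0 < j ->
  first_passage n.+1 j `&` [set z | z 0%N = y] =
  [set z | z 0%N = y] `&` reindex succn @^-1` first_passage n (j - y).
Proof.
move=> j0; apply/seteqP; split => [z [[nz kz] zy]|z [zy [nz kz]]].
  split=> //; split; first by rewrite lerBlDl -zy -partial_sumS.
  by move=> k kn; rewrite ltrBrDl -zy -partial_sumS; exact: kz.
split=> //; split; first by rewrite partial_sumS zy -lerBlDl.
by move=> [|k] kn; [rewrite partial_sum0|rewrite partial_sumS zy -ltrBrDl; exact: kz].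
Qed.

Local Notation conf := (config (I := nat) (T := int)).

Lemma measurable_first_passage n j : <<s cylinders setT >> (first_passage n j).
Proof.
elim: n j => [|n IH] j.
  rewrite first_passage0; case: ifP => _; first exact: (@measurableT _ conf).
  exact: (@measurable0 _ conf).
have [j0|j0] := leP j 0.
  by rewrite first_passageS_le0//; exact: (@measurable0 _ conf).
have -> : first_passage n.+1 j = \bigcup_y (first_passage n.+1 j `&` [set z | z 0%N = y]).
  apply/seteqP; split => [z fz|z [y _ []]//]; by exists (z 0%N).
apply: (@countable_bigcupT_measurable _ conf); first exact: countableP.
move=> y; rewrite first_passageS//; apply: (@measurableI _ conf).
  exact: (@cylinders_coord _ _ _ setT 0%N [set y]).
by apply: reindex_cylinders => //; exact: succn_inj.
Qed.

Lemma first_passage_disjoint n k j z :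
  first_passage n j z -> first_passage k j z -> n = k.
Proof.
move=> [nz nl] [kz kl]; apply/eqP; rewrite eqn_leq; apply/andP; split.
  by rewrite leqNgt; apply/negP => /nl; rewrite ltNge kz.
by rewrite leqNgt; apply/negP => /kl; rewrite ltNge nz.
Qed.

Variables (a : probability int R) (nu : probability conf R) (m : R).
Hypothesis nuE : is_product_law a nu.
Hypothesis m_bounds : 0 < m < 1.

Let t n j : R := fine (nu (first_passage n j)).

Let tE n j : nu (first_passage n j) = (t n j)%:E.
Proof. by rewrite /t fineK//; apply: fin_num_measure; exact: measurable_first_passage. Qed.

Let t_ge0 n j : 0 <= t n j. Proof. by rewrite fine_ge0. Qed.

Let m_ge0 : 0 <= m. Proof. by case/andP: m_bounds => /ltW. Qed.

Let term_ge0 n j : (0 <= (m ^+ n * t n j)%:E)%E.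
Proof. by rewrite lee_fin mulr_ge0// exprn_ge0. Qed.

Lemma first_passage_equation n j : 0 < j ->
  (nu (first_passage n.+1 j) = \int[a]_y (t n (j - y))%:E)%E.
Proof.
move=> j0; rewrite -[RHS]mul1e.
apply: (@disintegration _ _ _ _ _ nu a (@choice.pickle int) (fun z => z 0%N)) => //.
- exact: measurable_first_passage.
- by move=> y; exact: (@cylinders_coord _ _ _ setT 0%N [set y]).
move=> y; rewrite mul1e first_passageS//.
have mf : <<s cylinders setT >> (first_passage n (j - y)) by exact: measurable_first_passage.
rewrite (product_law_indep nuE (D1 := [set 0%N]) (D2 := [set k | (0 < k)%N])).
- rewrite (product_law_reindex nuE) ?tE//; last exact: succn_inj.
  congr (_ * _)%E.
  have := @nuE [fset 0%N]%fset (fun=> [set y]) (fun=> int_discrete _).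
  rewrite big_seq_fset1 => <-; congr (nu _); apply/seteqP; split => z zt.
    by move=> i; rewrite inE => /eqP ->.
  by apply: zt; rewrite inE.
- by apply/seteqP; split => // k [/= ->].
- exact: (@cylinders_coord _ _ _ [set 0%N] 0%N [set y]).
- by apply: reindex_cylinders => //; [exact: succn_inj|move=> _ [k _ <-]].
Qed.

(** This is [E (m ^ tau_j)], summed over the finite values of the passage time; an infinite time
    contributes 0. *)
Definition discounted_passage (j : int) : R :=
  fine (\sum_(n <oo) (m ^+ n * t n j)%:E)%E.

Lemma discounted_passage_bounds j :
  ((discounted_passage j)%:E = \sum_(n <oo) (m ^+ n * t n j)%:E)%E /\
  0 <= discounted_passage j <= 1.
Proof.
have s0 : (0 <= \sum_(n <oo) (m ^+ n * t n j)%:E)%E by exact: nneseries_ge0.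
have s1 : (\sum_(n <oo) (m ^+ n * t n j)%:E <= 1)%E.
  apply: (@le_trans _ _ (\sum_(n <oo) nu (first_passage n j))%E).
    apply: lee_nneseries => // n _; rewrite tE lee_fin ler_piMl//.
    by rewrite exprn_ile1// ltW//; case/andP: m_bounds.
  rewrite -measure_semi_bigcup.
  - apply: probability_le1; apply: bigcup_measurable => n _.
    exact: measurable_first_passage.
  - by move=> n; exact: measurable_first_passage.
  - by move=> n k _ _ [z [/first_passage_disjoint]]; exact.
  - by apply: bigcup_measurable => n _; exact: measurable_first_passage.
have sE : ((discounted_passage j)%:E = \sum_(n <oo) (m ^+ n * t n j)%:E)%E.
  by rewrite fineK// ge0_fin_numE// (le_lt_trans s1)// ltry.
by split=> //; rewrite -2!lee_fin sE s0 s1.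
Qed.

Lemma discounted_passage_le0 j : j <= 0 -> discounted_passage j = 1.
Proof.
move=> j0; apply: EFin_inj; rewrite (discounted_passage_bounds j).1.
rewrite nneseries_recl// eseries0 => [|[|n] // _ _].
  by rewrite adde0 expr0 mul1r /t first_passage0 j0 probability_setT.
by rewrite /t first_passageS_le0// measure0 mulr0.
Qed.

Lemma discounted_passage_equation j : 0 < j ->
  discounted_passage j = m * mean a (fun y => discounted_passage (j - y)).
Proof.
move=> j0; apply: EFin_inj; rewrite (discounted_passage_bounds j).1.
have sv : summable_fun a (fun y => discounted_passage (j - y)).
  apply: (@summable_bounded _ _ _ a int_discrete _ 1) => y.
  by have [_ /andP[v0 v1]] := discounted_passage_bounds (j - y); rewrite ger0_norm.
rewrite nneseries_recl// -nneseries_addn//.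
have -> : t 0 j = 0 by rewrite /t first_passage0 leNgt j0 measure0.
rewrite mulr0 add0e EFinM -EFin_mean//.
under eq_integral do rewrite (discounted_passage_bounds _).1.
rewrite integral_nneseries//.
rewrite -nneseriesZl; last by move=> n _; exact: integral_ge0.
apply: eq_eseriesr => n _; rewrite addn1 exprS -mulrA EFinM; congr (_ * _)%E.
under eq_integral do rewrite EFinM.
rewrite ge0_integralZl//.
- by rewrite -first_passage_equation// tE -EFinM.
- by move=> y _; rewrite lee_fin t_ge0.
- by rewrite lee_fin exprn_ge0.
Qed.

End first_passage.

(** * Exponential moments and the law of the walk *)

Section exponential_moment.
Context {R : realType}.
Variable a : probability int R.

(** Without positive jumps, the negative part [g] of the jump would have mean zero, hence vanish
    almost everywhere, forcing mass 1 at 0. *)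
Lemma positive_jump : ('E_a[(fun y : int => y%:~R : R)%R] = 0)%E ->
  (a [set 0%Z] < 1)%E -> exists2 y : int, 0 < y & (0 < a [set y])%E.
Proof.
move=> a_mean a0; apply: contrapT => ny.
have apos : a (~` [set y : int | y <= 0]) = 0%E.
  apply: (@null_above _ a 0) => y y0; apply/eqP/negPn/negP => ay; apply: ny.
  by exists y => //; rewrite lt_neqAle eq_sym ay measure_ge0.
pose g (y : int) : \bar R := (Num.max 0 (- y)%:~R)%:E.
have g0 y : (0 <= g y)%E by rewrite lee_fin le_max lexx.
have : (\int[a]_y g y = 0)%E.
  apply: oppe_inj; rewrite oppe0 -a_mean expectation.unlock -integral_ge0N//.
  apply: ae_eq_integral => //; exists (~` [set y : int | y <= 0]); split=> // y /= h y0.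
  apply: h => _; congr (_%:E).
  rewrite intrN (max_idPr _) ?opprK// oppr_ge0.
  by rewrite -[0]/(0%:~R) ler_int.
under eq_integral do rewrite -[g _](gee0_abs (g0 _)).
move=> /(ae_eq_integral_abs _ measurableT).
move=> /(_ (@discrete_measurable_fun _ _ int_discrete _ _ _)) [Z [mZ Z0 subZ]].
have : (a (~` [set 0%Z]) = 0)%E.
  apply/eqP; rewrite eq_le measure_ge0 andbT.
  apply: (@le_trans _ _ (a (~` [set y : int | y <= 0] `|` Z))).
    rewrite le_measure ?inE// => y /= /eqP yn0.
    have [y0|y0] := leP y 0; [right|by left; move: y0; rewrite ltNge => /negP].
    apply: subZ => /= /(_ Logic.I); rewrite /g => -[] /eqP.
    rewrite intrN gt_eqF// lt_max oppr_gt0 -[0]/(0%:~R) !ltr_int.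
    by apply/orP; right; rewrite lt_neqAle; apply/andP.
  apply: (le_trans (measureU2 _ _ _)) => //; rewrite -[leRHS]adde0.
  by apply: leeD; rewrite le_eqVlt; apply/orP; left; apply/eqP.
have af : a [set 0%Z] \is a fin_num by exact: fin_num_measure.
rewrite probability_setC// -(fineK af) -EFinB => -[e].
by move: a0; rewrite -(fineK af) lte_fin; lra.
Qed.

Hypothesis summable_exp : forall theta : R, 1 <= theta ->
  summable_fun a (fun y => theta ^ y).

(** Exponential moments are given for bases at least 1. Clamping extends the integrand to an open
    interval around 1, as differentiation-style domination theorems demand. *)
Let clamped_exp (x : R) (y : int) : R := (Num.max 1 x) ^ y.

Let continuous_exprz (y : int) : continuous (clamped_exp ^~ y).
Proof.
have cX n : continuous (fun x : R => (Num.max 1 x) ^+ n).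
  elim: n => [|n IH] x; first exact: cvg_cst.
  rewrite (_ : (fun x => _) = (fun x => Num.max 1 x * Num.max 1 x ^+ n)).
    apply: cvgM; last exact: IH.
    by apply: (@continuous_max _ _ (cst 1) id x); [exact: cvg_cst|exact: cvg_id].
  by apply/funext => z; rewrite exprS.
move=> x; case: y => n; first exact: cX.
apply: cvgV; last exact: cX.
by rewrite expf_neq0// gt_eqF// lt_max ltr01.
Qed.

Lemma exists_exponent (gamma : R) (y0 : int) : 1 < gamma -> 0 < y0 ->
  (0 < a [set y0])%E -> exists2 s : R, 1 < s & mean a (fun y => s ^ y) = gamma.
Proof.
move=> g1 y00 ay0.
have af : a [set y0] \is a fin_num by exact: fin_num_measure.
have ar0 : 0 < fine (a [set y0]) by rewrite fine_gt0// ay0 ltey_eq af.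
(* With [y0 >= 1], the single atom [y0] already contributes at least [b * a {y0} >= gamma] to the
   mean at [b], so the intermediate value theorem applies on [[1, b]]. *)
pose b := Num.max 1 (gamma / fine (a [set y0])).
have b1 : 1 <= b by rewrite le_max lexx.
pose F x := mean a (clamped_exp x).
have FE x : 1 <= x -> F x = mean a (fun y => x ^ y).
  by move=> x1; apply: eq_mean => y; rewrite /clamped_exp (max_idPr _).
have F1 : F 1 = 1.
  by rewrite FE// (eq_mean a (fun y => exp1rz _ y)) mean_cst.
have Fb : gamma <= F b.
  rewrite FE//.
  apply: (@le_trans _ _ (mean a (fun y => b * (y \in [set y0])%:R))).
    rewrite meanZ ?mean_indic//; first by rewrite -ler_pdivrMr// le_max lexx orbT.
    apply: (@summable_bounded _ _ _ a int_discrete _ 1) => y.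
    by case: (_ \in _); rewrite ?normr1 ?normr0.
  apply: le_mean => [||y]; last first.
  - have [->|yn] := eqVneq y y0.
      by rewrite mem_set// mulr1 -[leLHS]expr1z ler_weXz2l.
    rewrite memNset ?mulr0; last exact/eqP.
    by rewrite exprz_ge0// (le_trans ler01).
  - exact: summable_exp.
  - apply: (@summable_bounded _ _ _ a int_discrete _ b) => y.
    by case: (_ \in _); rewrite ?mulr1 ?mulr0 ?normr0 ?ger0_norm// (le_trans ler01).
have Fc : {within `[1, b], continuous F}.
  apply: continuous_in_subspaceT => x /[!inE]/= /[!in_itv]/= /andP[x1 xb].
  (* The dominating function uses [(b + 1) ^ y] for [y >= 0] and the constant 1 for [y < 0]. *)
  apply: (@continuity_under_integral _ _ _ a clamped_exp setT measurableT 0 (b + 1) _ _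
     (fun y => (b + 1) ^ y + 1)).
  - move=> z _; apply: summable_exp; by rewrite le_max lexx.
  - by apply: aeW => y _ z _; exact: continuous_exprz.
  - apply: (@integrableD _ _ _ a setT measurableT (EFin \o (fun y => (b + 1) ^ y)) (EFin \o cst 1)).
      by apply: summable_exp; rewrite lerDr (le_trans ler01).
    exact: summable_cst.
  - move=> z /=; rewrite in_itv/= => /andP[z0 zb]; apply: aeW => y _.
    have bz : Num.max 1 z <= b + 1 by rewrite ge_max (ltW zb) lerDr (le_trans ler01).
    have mz0 : 0 <= Num.max 1 z by rewrite le_max ler01.
    have b0 : 0 <= b + 1 by rewrite (le_trans mz0).
    rewrite ger0_norm ?exprz_ge0//; case: y => n.
      by rewrite ler_wpDr// lerXn2r// nnegrE.
    rewrite ler_wpDl ?exprz_ge0// -[clamped_exp z (Negz n)]/(Num.max 1 z ^- n.+1).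
    rewrite invf_le1 ?exprn_gt0 ?lt_max ?ltr01//.
    by rewrite exprn_ege1// le_max lexx.
  - by rewrite inE/= in_itv/=; apply/andP; split; [lra|lra].
have [|c /[!in_itv]/= /andP[c1 cb] Fc'] := IVT b1 Fc (v := gamma).
  by rewrite F1 (min_idPl _) ?(max_idPr _) ?Fb ?(ltW g1)// (le_trans _ Fb)// ltW.
exists c; last by rewrite -FE.
rewrite lt_neqAle c1 andbT; apply/eqP => c1'.
by move: g1; rewrite -Fc' -c1' F1 ltxx.
Qed.

End exponential_moment.

Section walk_law.
Context {d} {Omega : measurableType d} {R : realType}.
Variables (Q : probability Omega R) (a : probability int R).
Variable step : nat -> {RV Q >-> int}.
Hypothesis iid : is_iid_steps a step.

Lemma K_integral theta : 1 <= theta -> (K step theta = \int[a]_y (theta ^ y)%:E)%E.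
Proof.
move=> t1; have t0 : 0 <= theta by exact: le_trans t1.
rewrite /K expectation.unlock.
rewrite [RHS](eq_measure_integral (distribution Q (step 0%N))); last first.
  by move=> A mA _; exact/esym/(step_law iid).
rewrite ge0_integral_distribution//.
- by apply: eq_integral => w _; rewrite /walk big_ord1.
- by move=> y; rewrite lee_fin exprz_ge0.
Qed.

Lemma K_summable theta : 1 <= theta -> (K step theta < +oo)%E ->
  summable_fun a (fun y => theta ^ y) /\ K step theta = (mean a (fun y => theta ^ y))%:E.
Proof.
move=> t1; rewrite K_integral// => Ky.
have sf : summable_fun a (fun y => theta ^ y).
  apply/integrableP; split; first exact: discrete_measurable_fun.
  under eq_integral do rewrite /= ger0_norm ?exprz_ge0 ?(le_trans _ t1)//.
  exact: Ky.
by split=> //; rewrite EFin_mean.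
Qed.

(** The events [F n] of first passage at time [n] are disjoint, [pow_tau] equals [m ^+ n] on [F n],
    and it takes its default value 0 off their union. *)
Lemma walk_law (m : R) : 0 < m < 1 ->
  exists2 nu : probability (config (I := nat) (T := int)) R, is_product_law a nu &
    forall n : nat, fine ('E_Q[pow_tau step m n])%E = discounted_passage nu m n%:Z.
Proof.
move=> m01.
have mS i : measurable_fun setT (step i) by exact: measurable_funPT.
have [nu nuE nuP] := independent_family_law mS (step_indep iid) (step_law iid).
exists nu => // j.
pose Z (w : Omega) : nat -> int := fun i => step i w.
pose F n := [set w | first_passage n j%:Z (Z w)].
have mF n : measurable (F n) by have [] := nuP _ (measurable_first_passage n j%:Z).
have nuF n : nu (first_passage n j%:Z) = Q (F n).
  by have [] := nuP _ (measurable_first_passage n j%:Z).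
have m0 : 0 <= m by case/andP: m01 => /ltW.
have powF n w : F n w -> pow_tau step m j w = m ^+ n.
  move=> Fw; rewrite /pow_tau /tau; case: pselect => [h|[]]; last first.
    by exists n; case: Fw.
  case: ex_minnP => k kj kmin; congr (m ^+ _).
  apply: (@first_passage_disjoint k n j%:Z (Z w)) => //; split=> // i ik.
  by rewrite ltNge; apply/negP => /kmin; rewrite leqNgt ik.
have pow0 w : ~ (\bigcup_n F n) w -> pow_tau step m j w = 0.
  move=> nF; rewrite /pow_tau /tau; case: pselect => // h.
  case: ex_minnP => k kj kmin; case: nF; exists k => //; split=> // i ik.
  by rewrite ltNge; apply/negP => /kmin; rewrite leqNgt ik.
have pow_ge0 w : 0 <= pow_tau step m j w.
  by rewrite /pow_tau; case: tau => // n; rewrite exprn_ge0.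
have tF : trivIset setT F.
  by move=> n k _ _ [w [/first_passage_disjoint]]; exact.
rewrite /discounted_passage; congr fine; rewrite expectation.unlock.
transitivity (\int[Q]_(w in \bigcup_n F n) (pow_tau step m j w)%:E)%E.
  rewrite [RHS]integral_mkcond; apply: eq_integral => w _.
  by rewrite patchE; case: ifPn => // /negP; rewrite inE => /pow0 ->.
have mFp n : measurable_fun (F n) (pow_tau step m j).
  apply: (@eq_measurable_fun _ _ _ _ _ (cst (m ^+ n))).
    by move=> w /[!inE] /powF ->.
  exact: measurable_cst.
rewrite ge0_integral_bigcup//; last 2 first.
- by apply/measurable_EFinP/measurable_fun_bigcup.
- by move=> w _; rewrite lee_fin.
apply: eq_eseriesr => n _.
rewrite (eq_integral (cst (m ^+ n)%:E)); last by move=> w /[!inE] /powF ->.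
rewrite integral_cst// nuF EFinM fineK//.
exact: fin_num_measure.
Qed.

End walk_law.

(** * Asymptotics *)

Lemma limn_esup_le {R : realType} (f : nat -> \bar R) (l : \bar R) :
  (forall n, (f n <= l)%E) -> (limn_esup f <= l)%E.
Proof.
move=> fl; rewrite limn_esup_lim; apply: lime_le; first exact: is_cvg_esups.
by apply: nearW => n; apply: ub_ereal_sup => _ [k _ <-].
Qed.

Lemma limn_einf_ge {R : realType} (f : nat -> \bar R) (l : \bar R) :
  (forall n, (l <= f n)%E) -> (l <= limn_einf f)%E.
Proof.
move=> fl; rewrite limn_einf_lim; apply: lime_ge; first exact: is_cvg_einfs.
by apply: nearW => n; apply: le_ereal_inf_tmp => _ [k _ <-].
Qed.

Lemma cvg_log_rate {R : realType} (f : nat -> R) (rho c : R) :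
  0 < rho -> 0 < c -> (forall n, c * rho ^- n <= f n <= rho ^- n) ->
  (fun n => ln (f n) / n%:R) @ \oo --> - ln rho.
Proof.
(* The shift avoids division by [n = 0]. After taking logarithms, the constant [c] contributes only
   [ln c / n], which vanishes. *)
move=> rho0 c0 fb; rewrite -cvg_shiftS.
apply: (@squeeze_cvgr _ _ _ _ (fun n => ln c * n.+1%:R^-1 - ln rho) (fun=> - ln rho)).
- apply: nearW => n; have /andP[lo hi] := fb n.+1.
  have r0 : 0 < rho ^- n.+1 by rewrite invr_gt0 exprn_gt0.
  have cr0 : 0 < c * rho ^- n.+1 by rewrite mulr_gt0.
  have f0 : 0 < f n.+1 by exact: lt_le_trans lo.
  have lnr : ln (rho ^- n.+1) = - ln rho * n.+1%:R.
    by rewrite lnV ?posrE ?exprn_gt0// lnXn// mulNr mulr_natr.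
  apply/andP; split.
    rewrite ler_pdivlMr// mulrBl divfK//.
    have : ln (c * rho ^- n.+1) <= ln (f n.+1) by rewrite ler_ln.
    by rewrite lnM ?posrE// lnr mulNr.
  by rewrite ler_pdivrMr// -lnr ler_ln.
- rewrite -[X in _ --> X]add0r; apply: cvgD; last exact: cvg_cst.
  rewrite -[X in _ --> X](mulr0 (ln c)); apply: cvgMr.
  exact: cvg_harmonic.
- exact: cvg_cst.
Qed.

Theorem theorem1p2 (R : realType)
    (a : probability int R) (p : probability nat R) (m : R)
    (d : measure_display) (Omega : measurableType d) (P : probability Omega R)
    (xi : seq nat -> {RV P >-> int}) (N : seq nat -> {RV P >-> nat})
    (d' : measure_display) (Omega' : measurableType d')
    (Q : probability Omega' R) (step : nat -> {RV Q >-> int})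
    (brw : is_brw a p xi N) (iid : is_iid_steps a step)
    (p_mean : ('E_p[(fun k : nat => k%:R : R)%R] = m%:E)%E) (m_bounds : 0 < m < 1)
    (p_moment3 : ('E_p[(fun k : nat => k%:R ^+ 3 : R)%R] < +oo)%E)
    (a_mean : ('E_a[(fun y : int => y%:~R : R)%R] = 0)%E)
    (a_variance : (variance a (fun y : int => y%:~R : R)%R < +oo)%E)
    (a_nontrivial : (a [set 0%Z] < 1)%E)
    (K_finite : forall theta : R, 1 <= theta -> (K step theta < +oo)%E) :
  let ell := fun n : nat => (rho step (m^-1)) ^+ n * u xi N n in
  let log_tau :=
    fun n : nat => ln (fine ('E_Q[pow_tau step m n])%E) / n%:R : R in
  [/\ [/\ (0 < limn_einf (fun n => (ell n)%:E))%E,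
          (limn_einf (fun n => (ell n)%:E)
             <= limn_esup (fun n => (ell n)%:E))%E &
          (limn_esup (fun n => (ell n)%:E) <= 1)%E],
      (forall r : nat, right_range a r -> nearly_right_continuous a r ->
         exists kappa : R, 0 < kappa <= 1 /\ ell @ \oo --> kappa) &
      cvgn log_tau /\ ln (rho step (m^-1)) = - limn log_tau].
Proof.
have [m0 m1] := andP m_bounds.
have summable_exp theta : 1 <= theta -> summable_fun a (fun y => theta ^ y).
  by move=> t1; have [] := K_summable iid t1 (K_finite _ t1).
have [s1 Ks] : 1 < rho step m^-1 /\ K step (rho step m^-1) = (m^-1)%:E.
  have [y0 y00 ay0] := positive_jump a_mean a_nontrivial.
  have mV1 : 1 < m^-1 by rewrite invf_gt1.
  have [s s1 sE] := exists_exponent summable_exp mV1 y00 ay0.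
  (* Existence of a root rules out the default value 1 in the definition of [rho]. *)
  apply: (@xgetPex _ 1 [set s : R | 1 < s /\ K step s = (m^-1)%:E]).
  exists s; split => //; have [_ ->] := K_summable iid (ltW s1) (K_finite _ (ltW s1)).
  by rewrite sE.
move: (rho step m^-1) s1 Ks => s s1 Ks ell log_tau.
have summable_s i : summable_fun a (fun y : int => (s ^ y) ^+ i).
  rewrite (_ : (fun y : int => _) = fun y => (s ^+ i) ^ y).
    by apply: summable_exp; rewrite exprn_ege1// ltW.
  by apply/funext => y; rewrite !exprnP !exprz_exp mulrC.
have kappa1 : m * mean a (fun y : int => (s ^ y) ^+ 1) = 1.
  have [_] := K_summable iid (ltW s1) (K_finite _ (ltW s1)).
  by rewrite Ks => -[] <-; rewrite mulfV// gt_eqF.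
have s0 : 0 < s by exact: lt_trans s1.
pose G := survival p; pose b := mean p (fun k : nat => k%:R ^+ 2 : R).
have summable3 : summable_fun p (fun k : nat => k%:R ^+ 3).
  apply/integrableP; split; first exact: discrete_measurable_fun.
  under eq_integral do rewrite /= ger0_norm ?exprn_ge0//.
  by move: p_moment3; rewrite expectation.unlock.
(* The third moment dominates the first two, which give the Lipschitz constant [m] and the quadratic
   constant [b] of [G]. *)
have nat_cube i (k : nat) : (0 < i <= 3)%N -> `|k%:R ^+ i : R| <= k%:R ^+ 3.
  move=> /andP[i0 i3]; rewrite ger0_norm ?exprn_ge0// -!natrX ler_nat.
  case: k => [|k]; first by rewrite !exp0n.
  exact: leq_pexp2l.
have summable1 : summable_fun p (fun k : nat => k%:R).
  by apply: (summable_dom _ summable3) => // k; exact: (@nat_cube 1).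
have summable2 : summable_fun p (fun k : nat => k%:R ^+ 2).
  by apply: (summable_dom _ summable3) => // k; exact: nat_cube.
have mE : mean p (fun k : nat => k%:R) = m.
  by apply: EFin_inj; rewrite -EFin_mean// -p_mean expectation.unlock.
have [mu [nu [nuE muE uN]]] := brw_law brw.
pose U j := fine (nu (reach j)).
have U01 : forall j, 0 <= U j <= 1 by exact: reach_prob01.
have U1 : forall j, j <= 0 -> U j = 1 by exact: reach_prob_le0.
have UE : forall j, 0 < j -> U j = mean a (fun y => G (U (j - y))).
  by move=> j j0; exact (reach_equation nuE muE j0).
have G01 : forall t, 0 <= t <= 1 -> 0 <= G t <= 1 by exact: survival_bounds.
have Glip : forall t t', 0 <= t <= 1 -> 0 <= t' <= 1 ->
    G t <= G t' + m * Num.max 0 (t - t').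
  by rewrite -mE => t t'; exact: survival_lip.
have Gge : forall t, 0 <= t -> m * t - b * t ^+ 2 <= G (Num.min 1 t).
  by rewrite -mE => t; exact: survival_ge.
have G0 : G 0 = 0 by exact: survival0.
have b0 : 0 <= b by apply: mean_ge0 => k; rewrite exprn_ge0.
have Uup := solution_le_decay m_bounds s1 summable_s kappa1 G01 Glip G0 U01 UE.
have [c c0 Ulow] :=
  solution_ge_decay m_bounds s1 summable_s kappa1 b0 G01 Glip Gge U01 U1 UE.
have decayE (n : nat) : decay s n%:Z = s ^- n by rewrite /decay -invr_expz.
have sn0 (n : nat) : 0 < s ^+ n by rewrite exprn_gt0.
have ell1 n : ell n <= 1.
  by rewrite /ell uN mulrC -ler_pdivlMr// mul1r -decayE; exact: Uup.
have ellc n : c <= ell n.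
  by rewrite /ell uN mulrC -ler_pdivrMr// -decayE; exact: Ulow.
split.
- split; last 1 first.
  + by apply: limn_esup_le => n; rewrite lee_fin.
  + apply: (@lt_le_trans _ _ c%:E); first by rewrite lte_fin.
    by apply: limn_einf_ge => n; rewrite lee_fin.
  + exact: limn_einf_sup.
- move=> r [r0 _ ar] nrc.
  have [H H01 cvH] := solution_cvg m_bounds s1 summable_s kappa1 b0 G01 Glip G0
    Gge U01 U1 UE ar r0 nrc.
  exists H; split=> //; rewrite (_ : ell = fun n => s ^+ n * U n%:Z)//.
  by apply/funext => n; rewrite /ell uN.
have [nu' nu'E vN] := walk_law iid m_bounds.
pose v := discounted_passage nu' m.
have v01 j : 0 <= v j <= 1 by have [] := discounted_passage_bounds nu' m_bounds j.
have v1 j : j <= 0 -> v j = 1 by exact: discounted_passage_le0.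
have vE j : 0 < j -> v j = m * mean a (fun y => v (j - y)).
  exact: discounted_passage_equation.
have Usub j : 0 < j -> U j <= m * mean a (fun y => U (j - y)).
  exact: (solution_subsolution m_bounds G01 Glip G0 U01 UE).
have Uv := subsolution_le_solution m_bounds U01 v01 v1 Usub vE.
have vup : forall j, v j <= decay s j.
  by apply: (subsolution_le_decay m_bounds s1 summable_s kappa1 v01) => j /vE <-.
(* The sandwich [c * s ^- n <= U n <= v n <= s ^- n] fixes the exponential rate of [v]. *)
have cv : log_tau @ \oo --> - ln s.
  apply: (@cvg_log_rate _ _ _ c) => // n; rewrite vN -decayE vup andbT.
  exact: le_trans (Ulow _ _) (Uv _).
split; first by apply/cvg_ex; exists (- ln s).
by rewrite (cvg_lim _ cv) ?opprK.
Qed.
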